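(* Let $A, B \in M_n(\mathbb{C})$ be such that $e^{kA+lB} = e^{kA}e^{lB}$ for all $(k,l) \in \mathbb{Z}^2$. Then $AB = BA$.
   Context: $e^M = \exp(M)$ denotes the matrix exponential of $M \in M_n(\mathbb{C})$. *)

(* Defs.v *)
From Stdlib Require Import Reals ZArith Classical ClassicalEpsilon.
Open Scope R_scope.

Record C : Type := mkC { re : R ; im : R }.
Definition C0 : C := mkC 0 0.
Definition C1 : C := mkC 1 0.
Definition Cadd (z w : C) : C := mkC (re z + re w) (im z + im w).
Definition Cneg (z : C) : C := mkC (- re z) (- im z).
Definition Csub (z w : C) : C := Cadd z (Cneg w).
Definition Cmul (z w : C) : C :=
  mkC (re z * re w - im z * im w) (re z * im w + im z * re w).
Definition RtoC (x : R) : C := mkC x 0.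
Definition Cmod (z : C) : R := sqrt (re z * re z + im z * im z).

Fixpoint Csum (f : nat -> C) (m : nat) : C :=
  match m with O => C0 | S m' => Cadd (Csum f m') (f m') end.

Definition Cconv (u : nat -> C) (l : C) : Prop :=
  forall eps : R, eps > 0 -> exists N : nat, forall m : nat,
    (m >= N)%nat -> Cmod (Csub (u m) l) < eps.

(* n x n complex matrices: entries (i,j) with i,j < n are meaningful *)
Definition Mat : Type := nat -> nat -> C.
Definition Meq (n : nat) (A B : Mat) : Prop :=
  forall i j : nat, (i < n)%nat -> (j < n)%nat -> A i j = B i j.
Definition Mid : Mat := fun i j => if Nat.eqb i j then C1 else C0.
Definition Madd (A B : Mat) : Mat := fun i j => Cadd (A i j) (B i j).
Definition Mscale (c : C) (A : Mat) : Mat := fun i j => Cmul c (A i j).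
Definition Mmul (n : nat) (A B : Mat) : Mat :=
  fun i j => Csum (fun k => Cmul (A i k) (B k j)) n.
Fixpoint Mpow (n : nat) (A : Mat) (p : nat) : Mat :=
  match p with O => Mid | S p' => Mmul n A (Mpow n A p') end.

Definition Mexp_partial (n : nat) (A : Mat) (N : nat) : Mat :=
  fun i j => Csum (fun p => Cmul (RtoC (/ INR (fact p))) (Mpow n A p i j)) N.

Definition is_mexp (n : nat) (A E : Mat) : Prop :=
  forall i j : nat, (i < n)%nat -> (j < n)%nat ->
    Cconv (fun N => Mexp_partial n A N i j) (E i j).

Definition mexp (n : nat) (A : Mat) : Mat :=
  epsilon (inhabits (fun _ _ => C0)) (is_mexp n A).

Definition Zscale (k : Z) (A : Mat) : Mat := Mscale (RtoC (IZR k)) A.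

(* Main.v *)
Require Import Defs.
From Stdlib Require Import Reals ZArith Classical ClassicalEpsilon.
From HB Require Import structures.
From mathcomp Require Import all_boot all_order all_algebra all_field ring lra zify.
From mathcomp Require Import complex Rstruct.
Set Implicit Arguments. Unset Strict Implicit. Unset Printing Implicit Defensive.
Import Order.TTheory GRing.Theory Num.Theory.
Local Open Scope ring_scope.

(** Write A = D + N and B = D' + N' (Jordan-Chevalley). Semisimple and unipotent parts of an
invertible matrix are polynomials in it, so the hypothesis splits: kD + lD' is diagonalizable with
exponential e^(kD) e^(lD'), and it commutes with kN + lN'. Subtracting from D and D' logarithms S, S'
that are polynomials in e^D and e^D', one gets D - S and D' - S' all of whose integer combinations are
diagonalizable with eigenvalues in 2 i pi Z.

Suppose then that all kA + lB are diagonalizable with integer eigenvalues. By Gershgorin the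
eigenvalues of kA + B are of the form ka + c with a an eigenvalue of A and c in a fixed finite set of
integers, so the spectrum of the pencil A + xB lies on finitely many lines. Diagonalizability at
the points where lines meet shows that the spectral projectors are polynomial in x, then by degree
that they are constant; hence they diagonalize A and B simultaneously.

Once D and D' commute, [D, N'] = [N, D'] commutes with D, and D being diagonalizable this forces
[D, N'] = 0. *)

(** The obstacle is that the exponential, although injective on nilpotent matrices, sees the
    eigenvalues of a diagonalizable matrix only modulo 2 i pi Z. The pairs (1,1) and (-1,-1) already
    make e^A and e^B commute, which settles the nilpotent parts; the other pairs (k,l) serve to
    control this ambiguity. Taking S and S' as polynomials in e^D and e^D' pays off once D is known
    to commute with e^D' and D' with e^D: then, among D, D', S, S', the only commutator left in
    doubt is [D, D'].

    For integer spectra, the lines ka + c with the same a are parallel and meet only at infinity,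
    where a degree count loses them. The pencil is therefore replaced by A + x(MA + B), with lines a
    + x(Ma + c) and M = 2C + 1, where C bounds all |c|. Their slopes are pairwise distinct, so any
    two lines cross at a finite point; that point is rational, so the matrix there is a scalar
    multiple of an integer combination of A and B, hence diagonalizable. *)

Section CommNilpotent.
Variable R : nzRingType.
Implicit Types x y z : R.

Definition nilpotent_elt x := exists m, x ^+ m = 0.

Lemma nilpotent_eltD x y :
  GRing.comm x y -> nilpotent_elt x -> nilpotent_elt y -> nilpotent_elt (x + y).
Proof.
move=> cxy [a xa] [b yb]; exists (a + b)%N.
rewrite exprDn_comm // big1 // => i _.
have [ab|ba] := leqP b i.
  by rewrite -(subnK ab) exprD yb !mulr0 mul0rn.
suff -> : x ^+ (a + b - i) = 0 by rewrite mul0r mul0rn.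
have ai : (a <= a + b - i)%N by rewrite -addnBA ?leq_addr // ltnW.
by rewrite -(subnK ai) exprD xa mulr0.
Qed.

Lemma nilpotent_eltN x : nilpotent_elt x -> nilpotent_elt (- x).
Proof. by move=> [a xa]; exists a; rewrite exprNn xa mulr0. Qed.

Lemma nilpotent_eltB x y :
  GRing.comm x y -> nilpotent_elt x -> nilpotent_elt y -> nilpotent_elt (x - y).
Proof.
by move=> cxy nx ny; apply: nilpotent_eltD (nilpotent_eltN ny) => //; apply: commrN.
Qed.

Lemma nilpotent_eltM x y : GRing.comm x y -> nilpotent_elt x -> nilpotent_elt (y * x).
Proof. by move=> cxy [a xa]; exists a; rewrite exprMn_comm ?xa ?mulr0. Qed.

End CommNilpotent.

(** * Diagonalizable matrices: polynomials, commuting sums and products *)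

Section Diagonalizable.
Variables (F : fieldType) (n : nat).
Local Notation M := 'M[F]_n.+1.
Implicit Types A B D N P : M.

Lemma diagonalizable_horner0P A :
  diagonalizable A <->
  exists2 s, uniq s & horner_mx A (\prod_(a <- s) ('X - a%:P)) = 0.
Proof.
rewrite diagonalizableP; split=> -[s us hs]; exists s => //.
  exact/mxminpoly_minP.
exact/mxminpoly_minP.
Qed.

Lemma diagonalizable_conj P d :
  P \in unitmx -> diagonalizable (invmx P *m diag_mx d *m P).
Proof.
move=> uP; exists P => //; apply/(diagonalizable_forLR uP).
by exists d; exact/esym/conjVmx.
Qed.

Lemma codiagonalizable2 A B :
  GRing.comm A B -> diagonalizable A -> diagonalizable B ->
  exists2 P, P \in unitmx & exists a b,
    A = invmx P *m diag_mx a *m P /\ B = invmx P *m diag_mx b *m P.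
Proof.
move=> cAB dA dB.
have /codiagonalizableP[P uP] :
    {in [:: A; B] &, forall X Y, comm_mx X Y} /\
    {in [:: A; B], forall X, diagonalizable X}.
  split=> [X Y|X].
    by rewrite !inE => /orP[]/eqP-> /orP[]/eqP->.
  by rewrite !inE => /orP[]/eqP->.
rewrite /= andbT => /andP[/(diagonalizable_forLR uP)[a ha] /(diagonalizable_forLR uP)[b hb]].
by exists P => //; exists a, b; split; rewrite ?ha ?hb; exact: conjVmx.
Qed.

Lemma diagonalizable_decomp A : diagonalizable A ->
  exists2 P, P \in unitmx & exists d, A = invmx P *m diag_mx d *m P.
Proof.
by move=> dA; have [P uP [a [_ [ha _]]]] := codiagonalizable2 erefl dA dA; exists P => //; exists a.
Qed.

Lemma diagonalizableD A B : GRing.comm A B ->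
  diagonalizable A -> diagonalizable B -> diagonalizable (A + B).
Proof.
move=> cAB dA dB; have [P uP [a [b [-> ->]]]] := codiagonalizable2 cAB dA dB.
by rewrite -mulmxDl -mulmxDr -raddfD; apply: diagonalizable_conj.
Qed.

Lemma diagonalizableM A B : GRing.comm A B ->
  diagonalizable A -> diagonalizable B -> diagonalizable (A * B).
Proof.
move=> cAB dA dB; have [P uP [a [b [-> ->]]]] := codiagonalizable2 cAB dA dB.
rewrite -mulmxE !mulmxA mulmxK // -[_ *m diag_mx b]mulmxA mulmx_diag.
exact: diagonalizable_conj.
Qed.

Lemma diagonalizable_horner A p : diagonalizable A -> diagonalizable (horner_mx A p).
Proof.
move=> dA; have [P uP [d ->]] := diagonalizable_decomp dA.
by rewrite horner_mx_uconjC // horner_mx_diag; apply: diagonalizable_conj.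
Qed.

Lemma diagonalizableZ c A : diagonalizable A -> diagonalizable (c *: A).
Proof.
move=> dA; rewrite -[A in c *: A]horner_mx_X -horner_mxZ.
exact: diagonalizable_horner.
Qed.

Lemma diagonalizableB A B : GRing.comm A B ->
  diagonalizable A -> diagonalizable B -> diagonalizable (A - B).
Proof.
move=> cAB dA dB; rewrite -scaleN1r; apply: diagonalizableD (diagonalizableZ _ dB) => //.
by rewrite scaleN1r; apply: commrN.
Qed.

(** The device behind the uniqueness arguments: a difference is shown to vanish by proving it both
    diagonalizable and nilpotent. *)
Lemma diagonalizable_nilpotent A : diagonalizable A -> nilpotent_elt A -> A = 0.
Proof.
move=> dA [m]; have [P uP [d ->]] := diagonalizable_decomp dA.
rewrite -[_ *m P]horner_mx_X -rmorphXn /= horner_mx_uconjC // horner_mx_diag.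
move=> /(congr1 (fun X => P *m X *m invmx P)).
rewrite !mulmxA mulmxV // mul1mx -[_ *m P *m invmx P]mulmxA mulmxV // mulmx1 mulmx0 mul0mx.
move=> /matrixP hd; suff -> : d = 0 by rewrite raddf0 mulmx0 mul0mx horner_mx_X.
apply/rowP => i; have := hd i i; rewrite !mxE eqxx mulr1n hornerXn.
by move/eqP; rewrite expf_eq0 => /andP[_ /eqP].
Qed.

End Diagonalizable.

(** * The Jordan-Chevalley decomposition and its uniqueness *)

Section JordanChevalley.
Variables (F : closedFieldType) (n : nat).
Local Notation M := 'M[F]_n.+1.

Lemma poly_crt_XsubC (m : nat) (s : seq F) : uniq s ->
  exists p : {poly F}, {in s, forall a, ('X - a%:P) ^+ m %| p - a%:P}.
Proof.
elim: s => [|a s IH] /=; first by exists 0.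
move=> /andP[nas /IH[p hp]].
pose q := \prod_(b <- s) ('X - b%:P) ^+ m.
have cq : coprimep q (('X - a%:P) ^+ m).
  rewrite coprimep_expr // /q; elim: s nas {IH hp q} => [|b s IH] nas.
    by rewrite big_nil coprime1p.
  move: nas; rewrite inE negb_or => /andP[ab nas].
  rewrite big_cons coprimepMl IH // andbT coprimep_expl //.
  by rewrite coprimep_XsubC root_XsubC.
have /Bezout_eq1_coprimepP[[u v] /= huv] := cq.
(* By Bezout, [u * q] is 0 modulo the earlier moduli and 1 modulo the new one, so the correction
   turns [p] into [a] there without disturbing the other congruences. *)
exists (p + u * q * (a%:P - p)) => b; rewrite inE => /orP[/eqP->|bs].
  have -> : p + u * q * (a%:P - p) - a%:P = (v * (p - a%:P)) * ('X - a%:P) ^+ m.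
    have -> : u * q = 1 - v * ('X - a%:P) ^+ m by rewrite -huv addrK.
    ring.
  exact: dvdp_mulIr.
rewrite addrAC dvdp_add ?hp // dvdp_mulr // dvdp_mull // /q (big_rem b) //=.
exact: dvdp_mulIl.
Qed.

(** With [p] congruent to [a] modulo a high power of X - a, the matrix p(A) acts as the scalar [a]
    on the generalized eigenspace of each eigenvalue [a]. *)
Lemma jordan_chevalley (A : M) : exists p,
  diagonalizable (horner_mx A p) /\ nilpotent_elt (A - horner_mx A p).
Proof.
have [r hr] := closed_field_poly_normal (char_poly A).
(* The exponent dominates every multiplicity in the characteristic polynomial; the successor makes
   it visibly positive, so the congruences also hold modulo X - a. *)
pose s := undup r; pose m := (size r).+1.
have us : uniq s by apply: undup_uniq.
have [p hp] := poly_crt_XsubC m us; exists p.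
have key : horner_mx A (\prod_(a <- s) ('X - a%:P) ^+ m) = 0.
  apply/mxminpoly_minP; apply: dvdp_trans (mxminpoly_dvd_char A) _.
  rewrite hr (monicP (char_poly_monic A)) scale1r -(prodr_undup_exp_count r xpredT).
  apply: (big_ind2 (fun x y => x %| y)) => // [a b c d|a _]; first exact: dvdp_mul.
  by rewrite dvdp_exp2l // leqW // count_size.
have kill q : \prod_(a <- s) ('X - a%:P) ^+ m %| q -> horner_mx A q = 0.
  by move=> /dvdpP[t ->]; rewrite rmorphM /= key mulr0.
split.
  apply/diagonalizable_horner0P; exists s => //.
  have -> : horner_mx (horner_mx A p) (\prod_(a <- s) ('X - a%:P)) =
            horner_mx A (\prod_(a <- s) (p - a%:P)).
    rewrite !rmorph_prod; apply: eq_bigr => a _.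
    by rewrite !rmorphB /= !horner_mx_C horner_mx_X.
  apply: kill; rewrite big_seq [X in _ %| X]big_seq.
  by apply: (big_ind2 (fun x y => x %| y)) => // a b c d; apply: dvdp_mul.
exists m; rewrite -[A in A - _]horner_mx_X -rmorphB -rmorphXn /=; apply: kill.
rewrite prodrXl dvdp_exp2r // uniq_roots_dvdp ?uniq_rootsE //.
apply/allP => a /hp ha; rewrite /root !hornerE.
have : 'X - a%:P %| p - a%:P by apply: dvdp_trans ha; rewrite exprS dvdp_mulIl.
by rewrite dvdp_XsubCl /root !hornerE subr_eq0 => /eqP->; rewrite subrr.
Qed.

(** Since E - s = s(u - 1) is nilpotent, s - p(E) is a difference of commuting nilpotents; it is
    also diagonalizable, hence 0. One [p] serves all factorizations of [E]: this gives uniqueness of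
    [s], and [s] commutes with whatever commutes with [E]. *)
Lemma semisimple_part_horner (E : M) : exists p, forall s u : M,
  diagonalizable s -> GRing.comm s u -> nilpotent_elt (u - 1) -> E = s * u ->
  s = horner_mx E p.
Proof.
have [p [dp np]] := jordan_chevalley E; exists p => s u ds csu nu hE.
have csE : GRing.comm s E by rewrite hE; apply: commrM.
have csp : GRing.comm s (horner_mx E p) by apply: comm_mx_horner.
have cEp : GRing.comm E (horner_mx E p) by apply: comm_mx_horner.
apply/eqP; rewrite -subr_eq0; apply/eqP.
apply: diagonalizable_nilpotent; first exact: diagonalizableB.
have -> : s - horner_mx E p = (E - horner_mx E p) - s * (u - 1).
  by rewrite mulrBr mulr1 -hE opprB [RHS]addrC addrA subrK.
have cc : GRing.comm s (u - 1) by apply: commrB => //; apply: commr1.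
apply: nilpotent_eltB => //; last by apply: nilpotent_eltM => //; apply: commr_sym.
have -> : s * (u - 1) = E - s by rewrite mulrBr mulr1 hE.
apply: commrB; apply: commr_sym; apply: commrB => //; by apply: commr_sym.
Qed.

End JordanChevalley.

(** * Commutators with polynomials in a matrix *)

Section Commutation.
Variables (F : fieldType) (n : nat).
Local Notation M := 'M[F]_n.+1.
Implicit Types D N Z : M.

(** The bracket with N is a derivation; since [D, N] commutes with D, the Leibniz rule on powers of
    D collapses to the formal derivative. *)
Lemma horner_mx_commutator D N f : GRing.comm D (D * N - N * D) ->
  horner_mx D f * N - N * horner_mx D f = horner_mx D f^`() * (D * N - N * D).
Proof.
set Z := D * N - N * D => cZ.
have DN : D * N = N * D + Z by rewrite /Z addrC subrK.
elim/poly_ind: f => [|f c IH]; first by rewrite deriv0 !rmorph0 !(mul0r, mulr0) subr0.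
rewrite derivD derivM derivC derivX addr0 mulr1 !rmorphD !rmorphM /= horner_mx_X horner_mx_C.
have cfZ : GRing.comm Z (horner_mx D f) by apply: comm_mx_horner; apply: commr_sym.
have cc : c%:M * N = N * c%:M by apply: comm_scalar_mx.
rewrite mulrDl mulrDr cc opprD addrACA subrr addr0 -mulrA DN mulrDr.
transitivity ((horner_mx D f * N - N * horner_mx D f) * D + horner_mx D f * Z).
  by rewrite mulrBl !mulrA addrAC.
by rewrite IH mulrDl -!mulrA cZ.
Qed.

(* With f a separable polynomial killing D, the previous identity reads f'(D) [D, N] = 0 and f'(D) is invertible. *)
Lemma diagonalizable_ad2 D N : diagonalizable D ->
  GRing.comm D (D * N - N * D) -> GRing.comm D N.
Proof.
move=> /diagonalizable_horner0P[s us hs] cZ.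
have := horner_mx_commutator (\prod_(a <- s) ('X - a%:P)) cZ.
rewrite hs mul0r mulr0 subr0 => h.
have : separable_poly (\prod_(a <- s) ('X - a%:P)) by rewrite separable_prod_XsubC.
rewrite separable_poly.unlock => /Bezout_eq1_coprimepP[[u v] /= huv].
have h1 : horner_mx D v * horner_mx D (\prod_(a <- s) ('X - a%:P))^`() = 1.
  by have /(congr1 (horner_mx D)) := huv; rewrite rmorphD !rmorphM /= hs mulr0 add0r rmorph1.
by apply/eqP; rewrite -subr_eq0 -[_ - _]mul1r -h1 -mulrA -h mulr0.
Qed.

Lemma expr1DX (q : {poly F}) k : exists r, (1 + 'X * q) ^+ k = 1 + 'X * r.
Proof.
elim: k => [|k [r hr]]; first by exists 0; rewrite mulr0 addr0.
by exists (q + r + 'X * q * r); rewrite exprS hr; ring.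
Qed.

(** Meant for e^N - 1. Its k-th power is N^k plus higher powers of N, so commutation with N^k
    follows by descending induction on k. *)
Lemma comm_horner_nilpotent N Z q : nilpotent_elt N ->
  GRing.comm Z (horner_mx N ('X + 'X ^+ 2 * q)) -> GRing.comm Z N.
Proof.
move=> [m Nm] cZ.
(* [j] bounds how far [k] lies below the nilpotency index; for [j] = 0 the power N^k is already
   0. *)
suff H j : forall k, (0 < k)%N -> (m <= k + j)%N -> GRing.comm Z (N ^+ k).
  by rewrite -[N]expr1; apply: (H m); rewrite ?leq_addl.
elim: j => [|j IH] k k0 mk.
  by move: mk; rewrite addn0 => mk; rewrite -(subnK mk) exprD Nm mulr0; apply: commr0.
have [r hr] := expr1DX q k.
have : GRing.comm Z (horner_mx N ('X + 'X ^+ 2 * q) ^+ k) by apply: commrX.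
have -> : 'X + 'X ^+ 2 * q = 'X * (1 + 'X * q) by ring.
rewrite -rmorphXn /= exprMn hr mulrDr mulr1 rmorphD /= mulrA -exprSr rmorphXn /= horner_mx_X.
suff h : GRing.comm Z (horner_mx N ('X^(k.+1) * r)).
  by move=> h1; rewrite -[N ^+ k](addrK (horner_mx N ('X^(k.+1) * r))); apply: commrB.
rewrite -[r]coefK poly_def mulr_sumr rmorph_sum /=; apply: commr_sum => i _.
rewrite -scalerAr -exprD horner_mxZ rmorphXn /= horner_mx_X.
have : GRing.comm Z (N ^+ (k.+1 + i)).
  by apply: IH => //; apply: leq_trans mk _; rewrite addnS -addSn leq_add2r leq_addr.
by rewrite /GRing.comm -scalerAr -scalerAl => ->.
Qed.

(** The polynomial factors as N(1 + N q(N)), and the second factor is inverted by a finite geometric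
    sum. *)
Lemma horner_nilpotent_eq0 N q : nilpotent_elt N ->
  horner_mx N ('X + 'X ^+ 2 * q) = 0 -> N = 0.
Proof.
move=> [m Nm]; have -> : 'X + 'X ^+ 2 * q = 'X * (1 - ('X * - q)) by ring.
rewrite rmorphM /= horner_mx_X => h.
have : horner_mx N ((1 - ('X * - q)) * \sum_(i < m) ('X * - q) ^+ i) = 1.
  have -> : (1 - ('X * - q)) * \sum_(i < m) ('X * - q) ^+ i = 1 - ('X * - q) ^+ m.
    by rewrite -[RHS]opprB subrX1 -[RHS]mulNr opprB.
  by rewrite rmorphB rmorph1 exprMn rmorphM rmorphXn /= horner_mx_X Nm mul0r subr0.
by rewrite rmorphM => h1; rewrite -[N]mulr1 -h1 mulrA h mul0r.
Qed.

End Commutation.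

(** * Polynomial matrices: divisibility, degrees, Lagrange interpolation *)

Section PolyMatrix.
Variables (F : numFieldType) (n : nat).
Implicit Types (d e : {poly F}) (Q : 'M[{poly F}]_n.+1).

Lemma poly_eq0_nat (p : {poly F}) (x : nat -> F) :
  injective x -> (forall k, p.[x k] = 0) -> p = 0.
Proof.
move=> ix px; apply/eqP; apply/negPn/negP => p0.
have /(max_poly_roots p0) : all (root p) [seq x k | k <- iota 0 (size p)].
  by apply/allP => _ /mapP[k _ ->]; rewrite /root px.
by rewrite map_inj_uniq ?iota_uniq // size_map size_iota ltnn => /(_ isT).
Qed.

Lemma poly_nonroot (p : {poly F}) : p != 0 -> exists t, p.[t] != 0.
Proof.
move=> p0; pose u : seq F := [seq k%:R | k <- iota 0 (size p)].
have [/(max_poly_roots p0)|/allPn[t _ ht]] := boolP (all (root p) u); last by exists t.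
rewrite map_inj_uniq ?iota_uniq ?size_map ?size_iota ?ltnn; first by move=> /(_ isT).
by move=> k l /eqP; rewrite eqr_nat => /eqP.
Qed.

Definition dvdmx d Q := exists Q', Q = d *: Q'.

Lemma dvdmxM d e Q Q' : dvdmx d Q -> dvdmx e Q' -> dvdmx (d * e) (Q * Q').
Proof.
move=> [P ->] [P' ->]; exists (P * P').
by rewrite -scalerAl -scalerAr scalerA.
Qed.

Lemma dvdmxP d Q : (forall i j, d %| Q i j) -> dvdmx d Q.
Proof.
move=> dQ; exists (\matrix_(i, j) (Q i j %/ d)); apply/matrixP => i j.
by rewrite !mxE mulrC divpK.
Qed.

Lemma dvdmx_entry d Q i j : dvdmx d Q -> d %| Q i j.
Proof. by move=> [P ->]; rewrite mxE dvdp_mulIl. Qed.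

Lemma dvdmx_root t Q : map_mx (horner_eval t) Q = 0 -> dvdmx ('X - t%:P) Q.
Proof.
move=> /matrixP h; apply: dvdmxP => i j.
by have := h i j; rewrite !mxE => /eqP; rewrite dvdp_XsubCl.
Qed.

(** Powers at distinct points are coprime, so divisibility by a product over crossing points can be
    checked at one point at a time, with multiplicity. *)
Lemma dvdp_prod_XsubC_count (p : {poly F}) (ts : seq F) :
  {in ts, forall t, ('X - t%:P) ^+ count_mem t ts %| p} ->
  \prod_(t <- ts) ('X - t%:P) %| p.
Proof.
move=> h; rewrite -(prodr_undup_exp_count ts xpredT).
have : {in undup ts, forall t, ('X - t%:P) ^+ count_mem t ts %| p}.
  by move=> t; rewrite mem_undup => /h.
elim: (undup ts) (undup_uniq ts) => [|t u IH]; first by rewrite big_nil dvd1p.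
move=> /= /andP[nt uu] hu; rewrite big_cons Gauss_dvdp; last first.
  rewrite coprimep_expl // coprimep_sym; elim: u nt {IH uu hu} => [|v u IH].
    by rewrite big_nil coprime1p.
  rewrite inE negb_or => /andP[tv nt]; rewrite big_cons coprimepMl IH // andbT.
  by rewrite coprimep_expl // coprimep_XsubC root_XsubC.
rewrite hu ?inE ?eqxx // IH // => v vu.
by apply: hu; rewrite inE vu orbT.
Qed.

Definition degmx_le k Q := forall i j, (size (Q i j) <= k.+1)%N.

Lemma degmx_leM k l Q Q' : degmx_le k Q -> degmx_le l Q' -> degmx_le (k + l) (Q * Q').
Proof.
move=> hQ hQ' i j; rewrite mxE; apply: leq_trans (size_sum _ _ _) _.
apply/bigmax_leqP => m _; apply: leq_trans (size_polyMleq _ _) _.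
have pred_le (a b : nat) : (a <= b.+1)%N -> (a.-1 <= b)%N by case: a.
by apply: pred_le; have := leq_add (hQ i m) (hQ' m j); rewrite addSn addnS.
Qed.

Lemma degmx_le_prod (I : Type) (s : seq I) (G : I -> 'M[{poly F}]_n.+1) :
  (forall i, degmx_le 1 (G i)) -> degmx_le (size s) (\prod_(i <- s) G i).
Proof.
move=> hG; elim: s => [|i s IH].
  by rewrite big_nil => i j; rewrite !mxE; case: (i == j); rewrite ?mulr0n ?size_poly0 // size_poly1.
by rewrite big_cons -[size _]/(1 + size s)%N; apply: degmx_leM.
Qed.

Lemma horner_mx_eigen (R : comNzRingType) (Y Q : 'M[R]_n.+1) (l : R) (p : {poly R}) :
  Y * Q = l *: Q -> horner_mx Y p * Q = p.[l] *: Q.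
Proof.
move=> YQ; elim/poly_ind: p => [|p c IH]; first by rewrite rmorph0 horner0 mul0r scale0r.
rewrite rmorphD rmorphM /= horner_mx_X horner_mx_C hornerMXaddC mulrDl -mulrA YQ.
rewrite -scalerAr IH scalerA scalerDl mulrC; congr (_ + _).
exact: mul_scalar_mx.
Qed.

(** The difference of the two sides has degree below the number of nodes and vanishes at each of
    them. Evaluated at a matrix, the identity is the resolution of 1 into spectral projectors. *)
Lemma lagrange_sum1 (T : eqType) (s : seq T) (f : T -> F) :
  s != [::] -> uniq (map f s) ->
  \sum_(i <- s) (\prod_(j <- s | j != i) (f i - f j))^-1 *:
     \prod_(j <- s | j != i) ('X - (f j)%:P) = 1.
Proof.
move=> s0 us; have us' := map_uniq us.
apply/eqP; rewrite -subr_eq0; apply/negPn/negP => p0.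
set p := _ - 1 in p0; have : all (root p) [seq f i | i <- s].
  apply/allP => _ /mapP[i si ->]; rewrite /root /p !hornerE horner_sum.
  rewrite (bigD1_seq i) //= [X in _ + X - 1]big1 ?addr0 => [|k ki]; last first.
    apply/eqP; rewrite hornerZ horner_prod mulf_eq0 prodf_seq_eq0.
    by apply/orP; right; apply/hasP; exists i => //=; rewrite eq_sym ki !hornerE subrr eqxx.
  rewrite hornerZ horner_prod; under [X in _ * X]eq_bigr do rewrite !hornerE.
  rewrite mulVf ?subrr // prodf_seq_neq0; apply/allP => j sj; apply/implyP => ji.
  rewrite subr_eq0; apply: contra ji => /eqP fij.
  have /(uniqP (f i))/(_ (index j s) (index i s)) := us; rewrite !inE size_map !index_mem.
  move=> /(_ sj si); rewrite !(nth_map i) ?index_mem // !nth_index // fij => /(_ erefl) e.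
  by have <- : nth i s (index j s) = j; [exact: nth_index | rewrite e nth_index].
move=> /(max_poly_roots p0)/(_ us); rewrite size_map ltnNge => /negP; apply.
rewrite /p; apply: leq_trans (size_polyD _ _) _; rewrite geq_max size_polyN size_poly1.
apply/andP; split; last by case: (s) s0.
rewrite big_seq; apply: leq_trans (size_sum _ _ _) _; apply/bigmax_leqP_seq => i _ si.
apply: leq_trans (size_scale_leq _ _) _.
rewrite -big_filter size_prod_XsubC size_filter.
rewrite -(count_predC (pred1 i) s) -add1n leq_add // -?has_count ?has_pred1 //.
Qed.
End PolyMatrix.

(** * Pencils whose spectrum lies on finitely many lines *)

Section Pencil.
Variables (F : numFieldType) (n : nat) (A B : 'M[F]_n.+1) (s : seq (F * F)) (x : nat -> F).
(** A pair [c] encodes the line t -> c.1 + t c.2. Distinct slopes exclude parallel lines, so any two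
    of them meet at exactly one parameter. *)
Hypotheses (s0 : s != [::]) (us : uniq [seq c.2 | c <- s]) (x_inj : injective x).
Local Notation val c t := (c.1 + t * c.2).
Hypothesis kill_x : forall k,
  horner_mx (A + x k *: B) (\prod_(c <- s) ('X - (val c (x k))%:P)) = 0.
Hypothesis diag_cross : forall t c c', c \in s -> c' \in s -> c != c' ->
  val c t = val c' t -> diagonalizable (A + t *: B).

Let X : 'M[{poly F}]_n.+1 := map_mx polyC A + 'X *: map_mx polyC B.
Let L (c : F * F) : {poly F} := c.1%:P + 'X * c.2%:P.
Let ev t : 'M[{poly F}]_n.+1 -> 'M[F]_n.+1 := map_mx (horner_eval t).
Let oth c := [seq c' <- s | c' != c].
(** Lagrange numerator: divided by [D c], it is the spectral projector of the pencil onto the line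
    [c]. *)
Let N c := horner_mx X (\prod_(c' <- oth c) ('X - (L c')%:P)).

Let L_eval c t : (L c).[t] = val c t.
Proof. by rewrite /L !hornerE. Qed.

Let evX t : ev t X = A + t *: B.
Proof. by apply/matrixP => i j; rewrite !mxE /horner_eval !hornerE. Qed.

Let ev_factor t c : ev t (X - (L c)%:M) = (A + t *: B) - (val c t)%:M.
Proof. by rewrite /ev rmorphB /= -/(ev t X) evX map_scalar_mx /= /horner_eval L_eval. Qed.

Let horner_prodE (r : seq (F * F)) :
  horner_mx X (\prod_(c <- r) ('X - (L c)%:P)) = \prod_(c <- r) (X - (L c)%:M).
Proof.
by rewrite rmorph_prod; apply: eq_bigr => c _; rewrite rmorphB /= horner_mx_X horner_mx_C.
Qed.

Let horner_prodE0 t (r : seq (F * F)) :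
  horner_mx (A + t *: B) (\prod_(c <- r) ('X - (val c t)%:P)) =
  ev t (\prod_(c <- r) (X - (L c)%:M)).
Proof.
rewrite /ev !rmorph_prod; apply: eq_bigr => c _.
by rewrite rmorphB /= horner_mx_X horner_mx_C -ev_factor.
Qed.

Let ev_horner t (p : {poly F}) : ev t (horner_mx X (map_poly polyC p)) = horner_mx (A + t *: B) p.
Proof.
rewrite /ev map_horner_mx -/(ev t X) evX -map_poly_comp; congr (horner_mx _ _).
by apply: map_poly_id => v _ /=; rewrite /horner_eval hornerC.
Qed.

(** Each entry is a polynomial in the parameter with infinitely many zeros, namely the [x k]. *)
Let kill : \prod_(c <- s) (X - (L c)%:M) = 0.
Proof.
apply/matrixP => i j; rewrite [RHS]mxE; apply: (poly_eq0_nat x_inj) => k.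
have := kill_x k; rewrite horner_prodE0 => /matrixP/(_ i j).
by rewrite !mxE /horner_eval.
Qed.

Let kill_eval t : horner_mx (A + t *: B) (\prod_(c <- s) ('X - (val c t)%:P)) = 0.
Proof. by rewrite horner_prodE0 kill /ev map_mx0. Qed.

Let prod_oth (R : comNzRingType) (G : F * F -> R) c : c \in s ->
  \prod_(c' <- s) G c' = G c * \prod_(c' <- oth c) G c'.
Proof. by move=> sc; rewrite (bigD1_seq c) ?(map_uniq us) //= -big_filter. Qed.

Let factor_N c : c \in s -> X * N c = L c *: N c.
Proof.
move=> sc; apply/eqP; rewrite -subr_eq0 -[L c *: _]mul_scalar_mx -mulrBl; apply/eqP.
transitivity (horner_mx X (('X - (L c)%:P) * \prod_(c' <- oth c) ('X - (L c')%:P))).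
  by rewrite rmorphM rmorphB /= horner_mx_X horner_mx_C.
by rewrite -(prod_oth (fun c' => 'X - (L c')%:P)) // horner_prodE kill.
Qed.

Let cross (c c' : F * F) : F := (c'.1 - c.1) / (c.2 - c'.2).

Let othP c c' : c \in s -> c' \in oth c -> c' \in s /\ c.2 - c'.2 != 0.
Proof.
move=> sc; rewrite mem_filter => /andP[cc' sc']; split=> //.
rewrite subr_eq0; apply: contra cc' => /eqP e.
have h : index c.2 [seq c0.2 | c0 <- s] = index c'.2 [seq c0.2 | c0 <- s] by rewrite e.
move/(uniqP 0)/(_ (index c s) (index c' s)): us.
rewrite !inE size_map !index_mem !(nth_map c) ?index_mem // !nth_index // => /(_ sc sc' e) h'.
by have <- : nth c s (index c s) = c; [exact: nth_index | rewrite h' nth_index].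
Qed.

Let L_diff c c' : c \in s -> c' \in oth c ->
  L c - L c' = (c.2 - c'.2) *: ('X - (cross c c')%:P).
Proof.
move=> sc /(othP sc)[_ nz].
rewrite -mul_polyC mulrBr -polyCM /cross mulrCA mulfV // mulr1 /L !polyCB; ring.
Qed.

(* Let h collect the lines that avoid the crossing point at t. There X is diagonalizable, so each
   (X - L c') h(X) with c' through that point vanishes at t, whereas h(X) acts on N c as the scalar
   h(L c), which does not vanish at t. *)
Let cross_dvd c t : c \in s -> t \in [seq cross c c' | c' <- oth c] ->
  dvdmx (('X - t%:P) ^+ count_mem t [seq cross c c' | c' <- oth c]) (N c).
Proof.
move=> sc /mapP[c0 oc0 tE]; set r := count_mem _ _.
have meet c' : c' \in oth c -> (cross c c' == t) = (val c t == val c' t).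
  move=> oc'; have := congr1 (fun p => p.[t]) (L_diff sc oc').
  rewrite hornerD hornerN !L_eval hornerZ hornerXsubC; have [_ nz] := othP sc oc'.
  by move=> e; rewrite -(subr_eq0 (val c t)) e mulf_eq0 (negPf nz) /= subr_eq0 eq_sym.
pose G := [seq c' <- oth c | cross c c' == t].
pose H := [seq c' <- oth c | cross c c' != t].
pose h : {poly F} := \prod_(c' <- H) ('X - (val c' t)%:P).
have rG : r = size G by rewrite /r count_map size_filter; apply: eq_count => c' /=.
have dY : diagonalizable (A + t *: B).
  have [sc0 _] := othP sc oc0; apply: (@diag_cross t c c0) => //.
    by move: oc0; rewrite mem_filter eq_sym => /andP[].
  by apply/eqP; rewrite -meet // tE.
have splitG (R : comNzRingType) (K : F * F -> R) :
    \prod_(c' <- oth c) K c' = \prod_(c' <- G) K c' * \prod_(c' <- H) K c'.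
  by rewrite (bigID (fun c' => cross c c' == t)) /= -[X in X * _]big_filter -[X in _ * X]big_filter.
have GG (R : comNzRingType) (K : F -> R) :
    \prod_(c' <- G) K (val c' t) = K (val c t) ^+ r.
  transitivity (\prod_(c' <- G) K (val c t)); last first.
    by rewrite big_const_seq count_predT iter_mulr_1 rG.
  rewrite big_seq [RHS]big_seq; apply: eq_bigr => c'; rewrite mem_filter => /andP[ct oc'].
  by congr (K _); apply/esym/eqP; rewrite -meet.
(* At [t] the line [c] and the [r] lines of [G] share one value, so the annihilating product
   contains that factor r + 1 times. Hence the (r + 1)-th power of this matrix is 0, and
   diagonalizability lowers the exponent to 1. *)
have hY : horner_mx (A + t *: B) (('X - (val c t)%:P) * h) = 0.
  apply: diagonalizable_nilpotent; first exact: diagonalizable_horner.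
  exists r.+1; rewrite -rmorphXn /= exprMn exprS -mulrA [h ^+ _]exprS mulrA mulrA.
  rewrite rmorphM /= -mulrA -(GG _ (fun v => 'X - v%:P)) /h -splitG.
  by rewrite -(prod_oth (fun c' => 'X - (val c' t)%:P)) // kill_eval mul0r.
(* The roots of [h] stay frozen at their values at [t], so [hX] has coefficients constant in the
   parameter and specializes at [t] to [h]. *)
pose hX : {poly {poly F}} := map_poly polyC h.
have dvd_factor c' : c' \in G -> dvdmx ('X - t%:P) (horner_mx X (('X - (L c')%:P) * hX)).
  rewrite mem_filter => /andP[ct oc']; apply: dvdmx_root.
  have e : val c' t = val c t by apply/esym/eqP; rewrite -meet.
  rewrite rmorphM rmorphB /= horner_mx_X horner_mx_C map_mxM -/(ev t _) ev_factor e.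
  rewrite -/(ev t _) ev_horner -hY rmorphM rmorphB /= horner_mx_X horner_mx_C.
  by [].
have dvd_prod : dvdmx (('X - t%:P) ^+ r) (horner_mx X hX ^+ r * N c).
  rewrite /N -rmorphXn -rmorphM /= splitG mulrA rmorphM.
  rewrite -[X in dvdmx X]mulr1; apply: dvdmxM; last by exists (horner_mx X (\prod_(c' <- H) ('X - (L c')%:P))); rewrite scale1r.
  rewrite rG; elim: G dvd_factor {rG GG splitG} => [|c' G IH] hG /=.
    by rewrite big_nil expr0 mul1r rmorph1; exists 1; rewrite scale1r.
  rewrite big_cons !exprS mulrACA [hX * _]mulrC rmorphM; apply: dvdmxM.
    by apply: hG; rewrite inE eqxx.
  by apply: IH => c1 c1G; apply: hG; rewrite inE c1G orbT.
have wE : horner_mx X hX ^+ r * N c = hX.[L c] ^+ r *: N c.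
  by rewrite -rmorphXn /= (horner_mx_eigen _ (factor_N sc)) horner_exp.
apply: dvdmxP => i j; have := dvdmx_entry i j dvd_prod; rewrite wE mxE Gauss_dvdpr //.
rewrite coprimep_expl // coprimep_expr // coprimep_sym coprimep_XsubC /root.
rewrite -/(horner_eval t _) -horner_map /= -map_poly_comp /= /horner_eval L_eval.
have -> : map_poly (horner_eval t \o polyC) h = h.
  by apply: map_poly_id => v _ /=; rewrite /horner_eval hornerC.
rewrite /h horner_prod prodf_seq_neq0; apply/allP => c'; rewrite mem_filter => /andP[ct oc'] /=.
by rewrite !hornerE subr_eq0 -meet.
Qed.

Let D c := \prod_(c' <- oth c) (L c - L c').

Let D_neq0 c : c \in s -> D c != 0.
Proof.
move=> sc; rewrite /D prodf_seq_neq0; apply/allP => c' oc' /=.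
by rewrite L_diff // scaler_eq0 negb_or polyXsubC_eq0 andbT; have [] := othP sc oc'.
Qed.

(* N c and D c have the same degree, so their quotient is constant. *)
Let N_const c : c \in s -> exists P, N c = D c *: map_mx polyC P.
Proof.
move=> sc; pose ts := [seq cross c c' | c' <- oth c].
pose D0 := \prod_(t <- ts) ('X - t%:P).
pose k := \prod_(c' <- oth c) (c.2 - c'.2).
have k0 : k != 0 by rewrite prodf_seq_neq0; apply/allP => c' oc' /=; have [] := othP sc oc'.
have DE : D c = k *: D0.
  rewrite /D /k /D0 big_map -scaler_prod big_seq [RHS]big_seq.
  by apply: eq_bigr => c' oc'; rewrite L_diff.
have [Q NQ] : dvdmx D0 (N c).
  apply: dvdmxP => i j; apply: dvdp_prod_XsubC_count => t tt.
  exact/dvdmx_entry/cross_dvd.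
have degN : degmx_le (size ts) (N c).
  rewrite /N horner_prodE size_map; apply: degmx_le_prod => c' i j.
  rewrite !mxE /L; apply: leq_trans (size_polyD _ _) _; rewrite geq_max size_polyN.
  have deg1 (a b : F) : (size (a%:P + 'X * b%:P)%R <= 2)%N.
    apply: leq_trans (size_polyD _ _) _; rewrite geq_max size_polyC; apply/andP; split.
      by case: (a != 0).
    by apply: leq_trans (size_polyMleq _ _) _; rewrite size_polyX size_polyC; case: (b != 0).
  by rewrite deg1 /=; case: (i == j); rewrite ?mulr0n ?size_poly0 // mulr1n deg1.
have Qconst i j : Q i j = ((Q i j)`_0)%:P.
  apply: size1_polyC; have [->|q0] := eqVneq (Q i j) 0; first by rewrite size_poly0.
  have := degN i j; rewrite NQ mxE size_mul ?(monic_neq0 (monic_prod_XsubC _ _ _)) //.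
  by rewrite size_prod_XsubC addSn /= -[X in (_ <= X)%N -> _]addn1 leq_add2l.
exists (k^-1 *: map_mx (fun q : {poly F} => q`_0) Q); apply/matrixP => i j.
by rewrite DE NQ !mxE -mul_polyC polyCM [RHS]mulrACA -polyCM mulfV // mul1r -Qconst.
Qed.

(** The nonzero polynomial [D c] cancels, leaving an identity linear in the parameter; its values at
    0 and 1 separate [A] from [B]. *)
Let eigenP c P : c \in s -> N c = D c *: map_mx polyC P ->
  A * P = c.1 *: P /\ B * P = c.2 *: P.
Proof.
move=> sc NP; have h t : (A + t *: B) * P = val c t *: P.
  have e : X * map_mx polyC P = L c *: map_mx polyC P.
    apply/eqP; rewrite -subr_eq0; set W := _ - _.
    have W0 : D c *: W = 0.
      by rewrite scalerBr scalerAr -NP factor_N // NP !scalerA mulrC subrr.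
    apply/eqP/matrixP => i j; have := congr1 (fun V : 'M_n.+1 => V i j) W0.
    by rewrite !mxE => /eqP; rewrite mulf_eq0 (negPf (D_neq0 sc)) /= => /eqP.
  have evC : ev t (map_mx polyC P) = P.
    by apply/matrixP => i j; rewrite !mxE /horner_eval hornerC.
  transitivity (ev t (X * map_mx polyC P)).
    by rewrite /ev map_mxM -/(ev t X) -/(ev t (map_mx polyC P)) evX evC.
  by rewrite e /ev map_mxZ -/(ev t (map_mx polyC P)) evC /= /horner_eval L_eval.
have h0 : A * P = c.1 *: P by have := h 0; rewrite scale0r addr0 mul0r addr0.
split=> //; have := h 1; rewrite scale1r mul1r mulrDl scalerDl h0.
exact: addrI.
Qed.

(** The columns of each constant matrix [P] are killed by A - c.1 and B - c.2, hence by [A, B]. At a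
    parameter [t] avoiding all crossings, Lagrange interpolation writes 1 as a combination of these
    matrices. *)
Lemma pencil_comm : GRing.comm A B.
Proof.
have /poly_nonroot[t] : \prod_(c <- s) D c != 0.
  by rewrite prodf_seq_neq0; apply/allP => c /D_neq0.
rewrite horner_prod prodf_seq_neq0 => /allP /= Dt.
have ut : uniq [seq val c t | c <- s].
  rewrite map_inj_in_uniq ?(map_uniq us) // => c c' sc sc' e.
  apply/eqP/negPn/negP => cc'; have := Dt c sc.
  rewrite /D horner_prod prodf_seq_neq0 => /allP/(_ c'); rewrite mem_filter eq_sym cc' sc'.
  by move=> /(_ isT); rewrite hornerD hornerN !L_eval e subrr eqxx.
have := lagrange_sum1 s0 ut => /(congr1 (horner_mx (A + t *: B))).
rewrite rmorph1 rmorph_sum /= => sum1.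
apply/eqP; rewrite -subr_eq0 -[_ - _]mulr1 -sum1 mulr_sumr big_seq big1 // => c sc.
rewrite horner_mxZ -scalerAr -[X in horner_mx _ X]big_filter.
have [P NP] := N_const sc; have [AP BP] := eigenP sc NP.
have -> : horner_mx (A + t *: B) (\prod_(c' <- [seq c' <- s | c' != c]) ('X - (val c' t)%:P))
    = (D c).[t] *: P.
  rewrite horner_prodE0 -horner_prodE -/(oth c) -/(N c) NP.
  by apply/matrixP => i j; rewrite !mxE /horner_eval !hornerE.
by rewrite -scalerAr mulrBl -!mulrA AP BP -!scalerAr AP BP !scalerA [c.1 * _]mulrC subrr !scaler0.
Qed.
End Pencil.

(** * Pencils with integer eigenvalues *)

Section IntegralPencil.
Variables (F : numFieldType) (n : nat).
Implicit Types A B X : 'M[F]_n.+1.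

Definition int_diagonalizable X :=
  exists2 P, P \in unitmx & exists d : 'rV[int]_n.+1,
    X = invmx P *m diag_mx (map_mx intr d) *m P.

Lemma int_diagonalizableW X : int_diagonalizable X -> diagonalizable X.
Proof. by move=> [P uP [d ->]]; apply: diagonalizable_conj. Qed.

(* Gershgorin's disc argument for the perturbation B of the diagonal matrix k diag(a). *)
Lemma eigenvalue_diag_perturbation (a w : 'rV[F]_n.+1) B (k e : F) :
  w != 0 -> w *m (k *: diag_mx a + B) = e *: w ->
  exists i, `|e - k * a 0 i| <= \sum_m \sum_j `|B m j|.
Proof.
move=> w0 we; have [i wi] : exists i, forall j, `|w 0 j| <= `|w 0 i|.
  suff [i _ wi] : exists2 i, i \in enum 'I_n.+1 & {in enum 'I_n.+1, forall j, `|w 0 j| <= `|w 0 i|}.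
    by exists i => j; apply: wi; rewrite mem_enum.
  have : enum 'I_n.+1 != [::] by rewrite -size_eq0 size_enum_ord.
  elim: (enum _) => // j [|j' r] IH _.
    by exists j; rewrite ?mem_head // => m; rewrite inE => /eqP->.
  have [i ri hi] := IH isT.
  have [le|/ltW le] := real_leP (normr_real (w 0 j)) (normr_real (w 0 i)).
    by exists i => [|m]; [rewrite inE ri orbT | rewrite inE => /orP[/eqP->|/hi]].
  exists j; rewrite ?mem_head // => m; rewrite inE => /orP[/eqP->//|/hi h].
  exact: le_trans h le.
have wi0 : 0 < `|w 0 i|.
  rewrite normr_gt0; apply: contra w0 => /eqP wi0; apply/eqP/rowP => j.
  by have := wi j; rewrite wi0 normr0 normr_le0 => /eqP->; rewrite mxE.
exists i; have := congr1 (fun v : 'rV_n.+1 => v 0 i) we.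
rewrite mulmxDr -scalemxAr mul_mx_diag !mxE => h.
have h' : (e - k * a 0 i) * w 0 i = \sum_m w 0 m * B m i.
  by rewrite mulrBl -h addrAC -mulrA [a 0 i * _]mulrC subrr add0r.
rewrite -(ler_pM2r wi0) -normrM h' mulr_suml; apply: le_trans (ler_norm_sum _ _ _) _.
apply: ler_sum => m _; rewrite normrM mulrC ler_pM // ?normr_ge0 //.
by rewrite (bigD1 i) //= lerDl sumr_ge0.
Qed.

Lemma integral_pencil_comm A B :
  (forall x : F, exists m : nat, `|x| <= m%:R) ->
  (forall k l : int, int_diagonalizable (k%:~R *: A + l%:~R *: B)) ->
  GRing.comm A B.
Proof.
move=> archi H.
have [P uP [a hA]] : int_diagonalizable A.
  by have := H 1 0; rewrite scale1r scale0r addr0.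
pose B' := P *m B *m invmx P.
have [C hC] := archi (\sum_m \sum_j `|B' m j|).
have C_ge : \sum_m \sum_j `|B' m j| <= C%:R.
  apply: le_trans hC; apply: real_ler_norm; apply: ger0_real.
  by rewrite sumr_ge0 // => i _; rewrite sumr_ge0.
(* In a basis diagonalizing [A], the rows of [Q] become left eigenvectors of k diag(a) + B'. The
   bound [C] depends on [B'] only, not on [k]. *)
have eigen (k : int) Q (e : 'rV[int]_n.+1) j : Q \in unitmx ->
    k%:~R *: A + B = invmx Q *m diag_mx (map_mx intr e) *m Q ->
    exists i, (`|e 0 j - k * a 0 i| <= C)%R.
  move=> uQ hQ; pose w := row j Q *m invmx P.
  have [||i hi] := @eigenvalue_diag_perturbation (map_mx intr a) w B' k%:~R (e 0 j)%:~R.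
  - apply/negP => /eqP /(congr1 (mulmx^~ P)); rewrite mulmxKV // mul0mx.
    move=> /(congr1 (mulmx^~ (invmx Q))); rewrite -row_mul mulmxV // mul0mx.
    by move=> /rowP/(_ j); rewrite !mxE eqxx => /eqP; rewrite oner_eq0.
  - have -> : k%:~R *: diag_mx (map_mx intr a) + B' = P *m (k%:~R *: A + B) *m invmx P.
      rewrite mulmxDr mulmxDl -/B' hA -scalemxAr -scalemxAl; congr (_ *: _ + _).
      by rewrite !mulmxA mulmxV // mul1mx mulmxK.
    have QE : Q *m (k%:~R *: A + B) = diag_mx (map_mx intr e) *m Q.
      by rewrite hQ !mulmxA mulmxV // mul1mx.
    rewrite /w !mulmxA mulmxKV // -row_mul QE row_mul row_diag_mx -scalemxAl -rowE.
    by rewrite -scalemxAl mxE.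
  exists i; rewrite -(ler_int F) intr_norm rmorphB rmorphM /=.
  by move: hi; rewrite mxE => /le_trans; apply.
(* One more than the largest difference between elements of [cs], so that Ma + c determines both a
   and c. *)
pose M : int := (2 * C + 1)%:Z.
pose as_ := undup [seq a 0 i | i <- enum 'I_n.+1].
have in_as i : a 0 i \in as_ by rewrite mem_undup; apply/mapP; exists i; rewrite ?mem_enum.
pose cs : seq int := [seq m%:Z - C%:Z | m <- iota 0 (2 * C + 1)].
have csP c : (c \in cs) = (`|c| <= C%:Z).
  apply/mapP/idP => [[m]|hc]; first by rewrite mem_iota => hm ->; lia.
  by exists (absz (c + C%:Z)%R); [rewrite mem_iota; lia | lia].
have ucs : uniq cs by rewrite map_inj_uniq ?iota_uniq // => x y; lia.
pose prs := [seq (x, y) | x <- as_, y <- cs].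
have uprs : uniq prs by apply: allpairs_uniq; rewrite ?undup_uniq // => -[? ?] [? ?].
pose line (p : int * int) : F * F := (p.1%:~R, (M * p.1 + p.2)%:~R).
have prsE p : (p \in prs) = (p.1 \in as_) && (p.2 \in cs).
  case: p => x y; apply/allpairsP/andP => [[[u v] /= [hu hv [-> ->]]]|[hx hy]] //.
  by exists (x, y).
have scaleE (t : F) : A + t *: (M%:~R *: A + B) = (1 + t * M%:~R) *: A + t *: B.
  by rewrite scalerDr scalerA addrA scalerDl scale1r.
suff cM : GRing.comm A (M%:~R *: A + B).
  rewrite -[B](addKr (M%:~R *: A)); apply: commrD => //; apply: commrN.
  by rewrite /GRing.comm -scalerAr -scalerAl.
(* At x = 1/(k + 1) the pencil equals x((k + 1 + M)A + B). Its eigenvalues x((k + 1 + M)a + c) are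
   the values a + x(Ma + c) of the chosen lines, because x(k + 1) = 1. *)
apply: (@pencil_comm _ _ _ _ [seq line p | p <- prs] (fun k => k.+1%:R^-1)).
- rewrite -size_eq0 size_map -lt0n -has_predT; apply/hasP; exists (a 0 0, 0) => //.
  by rewrite prsE /= in_as csP; lia.
- rewrite -map_comp map_inj_in_uniq // => -[x c] [y d]; rewrite !prsE /= => /andP[_ hc] /andP[_ hd].
  move=> /intr_inj; move: hc hd; rewrite !csP => hc hd h.
  have xy : x = y by rewrite /M in h; nia.
  by move: h; rewrite xy => /addrI ->.
- by move=> k l /invr_inj /eqP; rewrite eqr_nat eqSS => /eqP.
- move=> k; set x : F := k.+1%:R^-1; pose K : int := k.+1%:Z + M.
  have k0 : (k.+1%:R : F) != 0 by rewrite pnatr_eq0.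
  have [Q uQ [e he]] := H K 1.
  have YE : A + x *: (M%:~R *: A + B) = invmx Q *m diag_mx (x *: map_mx intr e) *m Q.
    rewrite linearZ /= -scalemxAr -scalemxAl -he scaleE scalerDr !scalerA mulr1.
    by congr (_ *: _ + _); rewrite rmorphD /= mulrDr mulVf.
  rewrite YE horner_mx_uconjC // horner_mx_diag.
  suff -> : map_mx (horner (\prod_(c <- [seq line p | p <- prs]) ('X - (c.1 + x * c.2)%:P)))
       (x *: map_mx intr e) = 0 by rewrite raddf0 mulmx0 mul0mx.
  apply/rowP => j; rewrite !mxE horner_prod; apply/eqP; rewrite prodf_seq_eq0.
  rewrite scale1r in he; have [i hi] := eigen K Q e j uQ he.
  apply/hasP; exists (line (a 0 i, e 0 j - K * a 0 i)).
    by apply: map_f; rewrite prsE /= in_as csP.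
  rewrite /= hornerXsubC subr_eq0; apply/eqP.
  have xk : x * k.+1%:R = 1 by rewrite mulVf.
  rewrite /K !(intrD, intrM, mulrNz) -[k.+1%:Z%:~R]/(k.+1%:R : F). 
  move: (k.+1%:R : F) xk => y xy; rewrite -[X in _ = X + _]mul1r -xy; ring.
(* The crossing parameter is the rational (a2 - a1)/d, with [d] the difference of slopes;
   multiplying the pencil there by [d] gives an integer combination of [A] and [B]. *)
- move=> t c c' /mapP[[a1 c1] _ ->] /mapP[[a2 c2] _ ->] ne /= h.
  pose d : int := (M * a1 + c1) - (M * a2 + c2).
  have td : t * d%:~R = (a2 - a1)%:~R.
    by apply/eqP; rewrite -subr_eq0 /d !rmorphB /= mulrBr; apply/eqP; move/eqP: h; rewrite -subr_eq0 => /eqP <-; ring.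
  have d0 : d != 0.
    apply: contra ne => /eqP d0; move: td; rewrite d0 mulr0 => /esym/eqP.
    rewrite intr_eq0 subr_eq0 => /eqP a12; move: d0; rewrite /d a12 => /eqP.
    by rewrite subr_eq0 => /eqP cc; rewrite /line /= cc.
  have dF0 : (d%:~R : F) != 0 by rewrite intr_eq0.
  have -> : A + t *: (M%:~R *: A + B) =
      d%:~R^-1 *: ((d + (a2 - a1) * M)%:~R *: A + (a2 - a1)%:~R *: B).
    rewrite scaleE -[t](mulfK dF0) td scalerDr !scalerA [d%:~R^-1 * (a2 - a1)%:~R]mulrC.
    by congr (_ *: _ + _); rewrite [(d + _)%:~R]intrD [(_ * M)%:~R]intrM /= mulrDr mulVf // mulrA [d%:~R^-1 * _]mulrC.
  exact/diagonalizableZ/int_diagonalizableW.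
Qed.

End IntegralPencil.

(** * Sequences tending to zero *)

Section Null.
Variable R : realFieldType.
Implicit Types (t u : nat -> R) (e : R).

(* One-sided on purpose: it is only ever applied to nonnegative sequences or their upper bounds. *)
Definition null t := forall e, 0 < e -> exists N, forall m, (N <= m)%N -> t m < e.

Lemma null_le t u : (forall m, t m <= u m) -> null u -> null t.
Proof. by move=> tu nu e /nu[N hN]; exists N => m /hN; apply: le_lt_trans. Qed.

Lemma null0 : null (fun=> 0).
Proof. by move=> e e0; exists 0%N. Qed.

Lemma nullD t u : null t -> null u -> null (fun m => t m + u m).
Proof.
move=> nt nu e e0; have e2 : 0 < e / 2 by rewrite divr_gt0.
have [N hN] := nt _ e2; have [P hP] := nu _ e2.
exists (maxn N P) => m; rewrite geq_max => /andP[/hN tm /hP um].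
by rewrite [e]splitr ltrD.
Qed.

Lemma nullZ (K : R) t : 0 <= K -> null t -> null (fun m => K * t m).
Proof.
move=> K0 nt e e0; have K1 : 0 < K + 1 by rewrite ltr_wpDl.
have [N hN] := nt (e / (K + 1)) (divr_gt0 e0 K1); exists N => m /hN tm.
apply: (@le_lt_trans _ _ (K * (e / (K + 1)))); first by rewrite ler_wpM2l // ltW.
by rewrite mulrCA -[X in _ < X]mulr1 ltr_pM2l // ltr_pdivrMr // mul1r ltrDl.
Qed.

Lemma nullM t u : (forall m, 0 <= t m) -> (forall m, 0 <= u m) ->
  null t -> null u -> null (fun m => t m * u m).
Proof.
move=> t0 u0 nt nu e e0; have [N hN] := nt _ ltr01; have [P hP] := nu _ e0.
exists (maxn N P) => m; rewrite geq_max => /andP[/hN tm /hP um].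
by apply: le_lt_trans um; rewrite ler_piMl // ltW.
Qed.

Lemma null_sum (I : Type) (r : seq I) (t : I -> nat -> R) :
  (forall i, null (t i)) -> null (fun m => \sum_(i <- r) t i m).
Proof.
move=> nt; elim: r => [|i r IH].
  by apply: (null_le _ null0) => m; rewrite big_nil.
by apply: (null_le _ (nullD (nt i) IH)) => m; rewrite big_cons.
Qed.

Lemma null_cst (c : R) : null (fun=> c) -> c <= 0.
Proof.
move=> nc; rewrite leNgt; apply/negP => c0; have [N hN] := nc _ c0.
by have := hN N (leqnn N); rewrite ltxx.
Qed.

End Null.

(** * A submultiplicative norm on complex matrices *)

Section ComplexMatrixNorm.
Variables (R : rcfType) (n : nat).
Implicit Types (z w : R[i]) (X Y L : 'M[R[i]]_n.+1) (U V : nat -> 'M[R[i]]_n.+1).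

(** The l^1 norm is equivalent to the modulus, takes values in [R] rather than in [R[i]], and
    involves no square root. *)
Definition cabs z : R := `|complex.Re z| + `|complex.Im z|.

Lemma cabs_ge0 z : 0 <= cabs z.
Proof. by rewrite addr_ge0. Qed.

Lemma cabs0 : cabs 0 = 0.
Proof. by rewrite /cabs /= normr0 addr0. Qed.

Lemma cabs0_eq z : cabs z <= 0 -> z = 0.
Proof.
case: z => x y; rewrite /cabs /= => h.
have /eqP := le_anti (introT andP (conj h (cabs_ge0 (x +i* y)%C))).
by rewrite /cabs /= paddr_eq0 // !normr_eq0 => /andP[/eqP-> /eqP->].
Qed.

Lemma cabsN z : cabs (- z) = cabs z.
Proof. by case: z => x y; rewrite /cabs /= !normrN. Qed.

Lemma cabsD z w : cabs (z + w) <= cabs z + cabs w.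
Proof.
by case: z w => x y [u v]; rewrite /cabs /= addrACA lerD // ler_normD.
Qed.

Lemma cabsM z w : cabs (z * w) <= cabs z * cabs w.
Proof.
case: z w => x y [u v]; rewrite /cabs /=.
apply: (@le_trans _ _ ((`|x| * `|u| + `|y| * `|v|) + (`|x| * `|v| + `|y| * `|u|))).
  by rewrite lerD // -!normrM ?ler_normD // (le_trans (ler_normB _ _)).
by rewrite le_eqVlt; apply/orP; left; apply/eqP; ring.
Qed.

Lemma cabsZ (c : R) z : 0 <= c -> cabs (c%:C%C * z) = c * cabs z.
Proof.
move=> c0; case: z => x y; rewrite /cabs /= !mul0r subr0 addr0.
by rewrite !normrM (ger0_norm c0) mulrDr.
Qed.

Definition mxabs X : R := \sum_i \sum_j cabs (X i j).

Lemma mxabs_ge0 X : 0 <= mxabs X.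
Proof. by rewrite sumr_ge0 // => i _; rewrite sumr_ge0 // => j _; apply: cabs_ge0. Qed.

Lemma mxabs0 : mxabs 0 = 0.
Proof. by rewrite /mxabs big1 // => i _; rewrite big1 // => j _; rewrite mxE cabs0. Qed.

Lemma mxabs_entry X i j : cabs (X i j) <= mxabs X.
Proof.
rewrite /mxabs (bigD1 i) //= (bigD1 j) //= -addrA lerDl addr_ge0 // sumr_ge0 // => k _.
  exact: cabs_ge0.
by rewrite sumr_ge0 // => l _; apply: cabs_ge0.
Qed.

Lemma mxabs0_eq X : mxabs X <= 0 -> X = 0.
Proof.
move=> h; apply/matrixP => i j; rewrite mxE; apply: cabs0_eq.
exact: le_trans (mxabs_entry X i j) h.
Qed.

Lemma mxabsN X : mxabs (- X) = mxabs X.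
Proof. by apply: eq_bigr => i _; apply: eq_bigr => j _; rewrite mxE cabsN. Qed.

Lemma mxabsD X Y : mxabs (X + Y) <= mxabs X + mxabs Y.
Proof.
rewrite /mxabs -big_split; apply: ler_sum => i _; rewrite -big_split.
by apply: ler_sum => j _; rewrite mxE cabsD.
Qed.

Lemma mxabs_sum (I : Type) (r : seq I) (P : pred I) (G : I -> 'M[R[i]]_n.+1) :
  mxabs (\sum_(k <- r | P k) G k) <= \sum_(k <- r | P k) mxabs (G k).
Proof.
apply: (big_ind2 (fun X x => mxabs X <= x)) => //; first by rewrite mxabs0.
by move=> X x Y y hx hy; apply: le_trans (mxabsD _ _) (lerD hx hy).
Qed.

Lemma mxabsM X Y : mxabs (X * Y) <= mxabs X * mxabs Y.
Proof.
rewrite /mxabs mulr_suml; apply: ler_sum => i _.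
rewrite mulr_suml.
apply: (@le_trans _ _ (\sum_j \sum_k cabs (X i k) * cabs (Y k j))).
  apply: ler_sum => j _; rewrite mxE.
  apply: (big_ind2 (fun z x => cabs z <= x)) => [|z x w y hz hw|k _].
  - by rewrite cabs0.
  - exact: le_trans (cabsD _ _) (lerD hz hw).
  - exact: cabsM.
rewrite exchange_big; apply: ler_sum => k _; rewrite -mulr_sumr ler_wpM2l ?cabs_ge0 //.
rewrite [X in _ <= X](bigD1 k) //= lerDl sumr_ge0 // => l _.
by rewrite sumr_ge0 // => m _; apply: cabs_ge0.
Qed.

Lemma mxabsZ (c : R) X : 0 <= c -> mxabs (c%:C%C *: X) = c * mxabs X.
Proof.
move=> c0; rewrite /mxabs mulr_sumr; apply: eq_bigr => i _.
by rewrite mulr_sumr; apply: eq_bigr => j _; rewrite mxE cabsZ.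
Qed.

(** The factor [mxabs 1] is there because this norm of the identity is the size of the matrix, not
    1. *)
Lemma mxabsX X p : mxabs (X ^+ p) <= mxabs 1 * mxabs X ^+ p.
Proof.
elim: p => [|p IH]; first by rewrite !expr0 mulr1.
rewrite !exprS mulrCA; apply: le_trans (mxabsM _ _) _.
by rewrite ler_wpM2l // mxabs_ge0.
Qed.

Definition mxcvg U L := null (fun m => mxabs (U m - L)).

Lemma mxcvg_unique U L L' : mxcvg U L -> mxcvg U L' -> L = L'.
Proof.
move=> h h'; apply/eqP; rewrite -subr_eq0; apply/eqP/mxabs0_eq.
apply: null_cst; apply: null_le (nullD h h') => m.
rewrite -[mxabs (U m - L)]mxabsN opprB.
by apply: le_trans (mxabsD _ _); rewrite addrA subrK.
Qed.

Lemma mxcvg_eq U V L : (forall m, U m = V m) -> mxcvg U L -> mxcvg V L.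
Proof. by move=> UV; apply: null_le => m; rewrite UV. Qed.

Lemma mxcvg_cst L : mxcvg (fun=> L) L.
Proof. by apply: null_le (@null0 R) => m; rewrite subrr mxabs0. Qed.

Lemma mxcvgB U V L M : mxcvg U L -> mxcvg V M -> mxcvg (fun m => U m - V m) (L - M).
Proof.
move=> hU hV; apply: null_le (nullD hU hV) => m.
rewrite -[mxabs (V m - M)]mxabsN; apply: le_trans (mxabsD _ _).
by rewrite !opprB addrACA [X in _ <= mxabs X]addrACA [- L - V m]addrC.
Qed.

Lemma mxcvgM U V L M : mxcvg U L -> mxcvg V M -> mxcvg (fun m => U m * V m) (L * M).
Proof.
move=> hU hV.
have h1 := nullM (fun m => mxabs_ge0 _) (fun m => mxabs_ge0 _) hU hV.
have h2 := nullZ (mxabs_ge0 L) hV; have h3 := nullZ (mxabs_ge0 M) hU.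
apply: null_le (nullD (nullD h1 h2) h3) => m.
have -> : U m * V m - L * M = (U m - L) * (V m - M) + L * (V m - M) + (U m - L) * M.
  by rewrite -mulrDl subrK mulrBr mulrBl addrA subrK.
apply: le_trans (mxabsD _ _) (lerD (le_trans (mxabsD _ _) (lerD _ _)) _); rewrite ?mxabsM //.
by rewrite mulrC; apply: mxabsM.
Qed.

Lemma mxcvg_null U L (K : R) t : 0 <= K -> null t ->
  (forall m, mxabs (U m - L) <= K * t m) -> mxcvg U L.
Proof. by move=> K0 nt h; apply: null_le h (nullZ K0 nt). Qed.

Lemma mxcvg_entry U L i j : mxcvg U L -> null (fun m => cabs (U m i j - L i j)).
Proof.
by apply: null_le => m; have := mxabs_entry (U m - L) i j; rewrite !mxE.
Qed.

End ComplexMatrixNorm.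

(** * Partial sums of the exponential series in an algebra *)

Section ExpSum.
Variables (K : numFieldType) (A : algType K).
Implicit Types X Y Z : A.

Definition expterm X p : A := (p`!%:R)^-1 *: X ^+ p.
Definition expsum m X : A := \sum_(p < m) expterm X p.

Lemma expterm_binomial X Y p : GRing.comm X Y ->
  expterm (X + Y) p = \sum_(i < p.+1) expterm X i * expterm Y (p - i).
Proof.
move=> cXY; rewrite /expterm addrC exprDn_comm; last exact: commr_sym.
rewrite scaler_sumr; apply: eq_bigr => i _.
have ip : (i <= p)%N by rewrite -ltnS.
rewrite -scalerMnr -scalerAl -scalerAr scalerA.
have -> : Y ^+ (p - i) * X ^+ i = X ^+ i * Y ^+ (p - i).
  by apply/esym/commrX/commr_sym/commrX/commr_sym.
rewrite -scaler_nat scalerA; congr (_ *: _).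
have f0 k : (k`!%:R : K) != 0 by rewrite pnatr_eq0 -lt0n fact_gt0.
apply: (mulfI (f0 p)); rewrite mulrCA mulfV // mulr1.
by rewrite -(bin_fact ip) !natrM; field; rewrite !f0.
Qed.

Lemma expsumD_triangle X Y m : GRing.comm X Y ->
  expsum m (X + Y) = \sum_(i < m) \sum_(0 <= j < m - i) expterm X i * expterm Y j.
Proof.
move=> cXY; elim: m => [|m IH]; first by rewrite /expsum !big_ord0.
rewrite /expsum big_ord_recr /= -/(expsum m _) IH expterm_binomial //.
transitivity (\sum_(i < m.+1) (\sum_(0 <= j < m - i) expterm X i * expterm Y j
    + expterm X i * expterm Y (m - i))).
  by rewrite big_split /= [X in _ = X + _]big_ord_recr /= subnn big_geq // addr0.
by apply: eq_bigr => i _; rewrite subSn ?big_nat_recr // -ltnS.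
Qed.

(** What remains is the part i + j >= m of the square i, j < m. Stated in any algebra, it gives the
    same index set for matrices and for the real numbers that dominate them. *)
Lemma expsumM_sub X Y m : GRing.comm X Y ->
  expsum m X * expsum m Y - expsum m (X + Y) =
  \sum_(i < m) \sum_(m - i <= j < m) expterm X i * expterm Y j.
Proof.
move=> cXY; rewrite expsumD_triangle // /expsum mulr_suml -sumrB.
apply: eq_bigr => i _; rewrite mulr_sumr -(big_mkord xpredT (fun j => expterm X i * expterm Y j)).
by rewrite (big_cat_nat (n := m - i)) ?leq_subr //= [X in X - _]addrC addrK.
Qed.

End ExpSum.

Local Notation R := Rdefinitions.R.

(** * The real exponential as a dominating series *)

Section RealExp.

Definition rexpsum m (a : R) : R := \sum_(p < m) p`!%:R^-1 * a ^+ p.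

Lemma rexpsum_cvg a : null (fun m => `|rexpsum m a - exp a|).
Proof.
move=> e /RltP e0.
have [N hN] := proj2_sig (exist_exp a) e e0.
exists N.+1 => -[//|m] Nm.
have /RltP := hN m (elimT ssrnat.leP (Nm : (N <= m)%N)); rewrite RdistE sum_f_R0E big_mkord.
apply: le_lt_trans; rewrite le_eqVlt; apply/orP; left; apply/eqP; congr (`|_ - _|).
by apply: eq_bigr => p _; rewrite RinvE INRE factE RpowE.
Qed.

(** The addition law of the real exponential enters here; the decay of the matrix remainder will be
    deduced from it. *)
Lemma rexpsumM_cvg a b :
  null (fun m => rexpsum m a * rexpsum m b - rexpsum m (a + b)).
Proof.
have na := rexpsum_cvg a; have nb := rexpsum_cvg b; have nab := rexpsum_cvg (a + b).
have n1 := nullM (fun m => normr_ge0 _) (fun m => normr_ge0 _) na nb.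
have n2 := nullZ (normr_ge0 (exp a)) nb; have n3 := nullZ (normr_ge0 (exp b)) na.
apply: null_le (nullD (nullD (nullD n1 n2) n3) nab) => m.
set x := rexpsum m a; set y := rexpsum m b; set z := rexpsum m (a + b).
have -> : x * y - z = (x - exp a) * (y - exp b) + exp a * (y - exp b)
    + exp b * (x - exp a) - (z - exp (a + b)).
  rewrite -[exp (a + b)]expRD; ring.
apply: le_trans (ler_norm _) _; rewrite -!normrM.
do 3! (apply: le_trans (ler_normD _ _) _; rewrite ?normrN lerD //).
Qed.

Lemma rexpsum_cauchy a e : 0 < e -> exists N, forall k m, (N <= k)%N -> (N <= m)%N ->
  `|rexpsum m a - rexpsum k a| < e.
Proof.
move=> e0; have [N hN] := rexpsum_cvg a (divr_gt0 e0 (ltr0Sn R 1)).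
exists N => k m /hN hk /hN hm; rewrite [e]splitr.
apply: le_lt_trans (ltrD hm hk); rewrite [X in _ <= _ + X]distrC.
by apply: le_trans (ler_normD _ _); rewrite addrA subrK.
Qed.

End RealExp.

(** * The matrix exponential *)

Section MatrixExp.
Variable n : nat.
Local Notation C := R[i].
Local Notation M := 'M[C]_n.+1.
Implicit Types X Y Z P : M.

Lemma mxabs_expterm X p :
  mxabs (expterm X p) <= mxabs (1 : M) * (p`!%:R^-1 * mxabs X ^+ p).
Proof.
have f0 : 0 <= (p`!%:R : R)^-1 by rewrite invr_ge0 ler0n.
have -> : expterm X p = (p`!%:R^-1 : R)%:C%C *: X ^+ p by rewrite /expterm fmorphV rmorph_nat.
by rewrite mxabsZ // mulrCA ler_wpM2l // mxabsX.
Qed.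

Lemma expsum_dist X m k :
  mxabs (expsum m X - expsum k X) <=
  mxabs (1 : M) * `|rexpsum m (mxabs X) - rexpsum k (mxabs X)|.
Proof.
wlog km : m k / (k <= m)%N => [h|].
  have [/h //|/ltnW/h] := leqP k m.
  by rewrite -mxabsN opprB distrC.
rewrite /expsum /rexpsum -!(big_mkord xpredT (expterm X)).
rewrite -!(big_mkord xpredT (fun p => p`!%:R^-1 * mxabs X ^+ p)).
rewrite (big_cat_nat (n := k)) //= [X in _ <= _ * `|X - _|](big_cat_nat (n := k)) //=.
rewrite [X in mxabs (X - _)]addrC addrK [X in `|X - _|]addrC addrK; apply: le_trans (mxabs_sum _ _ _) _.
apply: le_trans (ler_sum _ (fun p _ => mxabs_expterm X p)) _.
by rewrite -mulr_sumr ler_wpM2l ?mxabs_ge0 // ler_norm.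
Qed.

Lemma mxcvgP (U : nat -> M) (L : M) :
  (forall i j, null (fun m => cabs (U m i j - L i j))) -> mxcvg U L.
Proof.
move=> h; apply: null_le (null_sum (index_enum _) (fun i => null_sum (index_enum _) (h i))) => m.
by apply: ler_sum => i _; apply: ler_sum => j _; rewrite !mxE.
Qed.

Lemma real_cauchy_cvg (u : nat -> R) :
  (forall e, 0 < e -> exists N, forall k m, (N <= k)%N -> (N <= m)%N -> `|u m - u k| < e) ->
  exists l, null (fun m => `|u m - l|).
Proof.
move=> cu; have [e /RltP/cu[N hN]|l hl] := R_complete u.
  by exists N => m k Nm Nk; apply/RltP; rewrite RdistE; apply: hN; apply/ssrnat.leP.
exists l => e /RltP/hl[N hN]; exists N => m /ssrnat.leP Nm.
by have /RltP := hN m Nm; rewrite RdistE.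
Qed.

Lemma expsum_cvg X : exists E, mxcvg (fun m => expsum m X) E.
Proof.
have cauchy e : 0 < e -> exists N, forall k m, (N <= k)%N -> (N <= m)%N ->
    mxabs (expsum m X - expsum k X) < e.
  move=> e0; have K1 : 0 < mxabs (1 : M) + 1 by rewrite ltr_wpDl ?mxabs_ge0.
  have [N hN] := rexpsum_cauchy (mxabs X) (divr_gt0 e0 K1).
  exists N => k m Nk Nm; apply: le_lt_trans (expsum_dist X m k) _.
  have lt := hN k m Nk Nm.
  apply: (@le_lt_trans _ _ (mxabs (1 : M) * (e / (mxabs (1 : M) + 1)))).
    by rewrite ler_wpM2l ?mxabs_ge0 // ltW.
  by rewrite mulrCA -[X in _ < X]mulr1 ltr_pM2l // ltr_pdivrMr // mul1r ltrDl.
have entry i j : exists z, null (fun m => cabs (expsum m X i j - z)).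
  have part (f : C -> R) (fB : forall z w, `|f z - f w| <= cabs (z - w)) :
      exists l, null (fun m => `|f (expsum m X i j) - l|).
    apply: real_cauchy_cvg => e /cauchy[N hN]; exists N => k m Nk Nm.
    apply: le_lt_trans (hN k m Nk Nm); apply: le_trans (fB _ _) _.
    by have := mxabs_entry (expsum m X - expsum k X) i j; rewrite !mxE.
  have [|x hx] := part (@complex.Re R).
    by case=> a b [c d]; rewrite /cabs /= lerDl.
  have [|y hy] := part (@complex.Im R).
    by case=> a b [c d]; rewrite /cabs /= lerDr.
  exists (x +i* y)%C; apply: null_le (nullD hx hy) => m.
  by case: (expsum m X i j).
pose L : M := \matrix_(i, j) sval (constructive_indefinite_description _ (entry i j)).
exists L; apply: mxcvgP => i j; rewrite mxE.
exact: svalP (constructive_indefinite_description _ (entry i j)).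
Qed.

(* Opaque, so that unification never unfolds the limit. *)
Lemma mxexp_sig : {f : M -> M | forall X, mxcvg (fun m => expsum m X) (f X)}.
Proof.
by exists (fun X => sval (constructive_indefinite_description _ (expsum_cvg X))) => X; case: constructive_indefinite_description.
Qed.

Definition mxexp X : M := sval mxexp_sig X.

Lemma mxexp_cvg X : mxcvg (fun m => expsum m X) (mxexp X).
Proof. exact: svalP mxexp_sig X. Qed.

(** Bounded term by term, the remainder of the product of partial sums is at most a constant times
    the real remainder at [mxabs X] and [mxabs Y], which tends to 0. *)
Lemma mxexpD X Y : GRing.comm X Y -> mxexp (X + Y) = mxexp X * mxexp Y.
Proof.
move=> cXY; apply/esym/eqP; rewrite -subr_eq0; apply/eqP.
apply: mxcvg_unique (mxcvgB (mxcvgM (mxexp_cvg X) (mxexp_cvg Y)) (mxexp_cvg (X + Y))) _.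
set K := mxabs (1 : M); have K0 : 0 <= K by apply: mxabs_ge0.
apply: (@mxcvg_null _ _ _ _ (K * K) _ _ (rexpsumM_cvg (mxabs X) (mxabs Y))) => [|m].
  by rewrite mulr_ge0.
rewrite subr0 expsumM_sub //.
have -> : rexpsum m (mxabs X) * rexpsum m (mxabs Y) - rexpsum m (mxabs X + mxabs Y) =
    \sum_(i < m) \sum_(m - i <= j < m)
      ((i`!%:R^-1 * mxabs X ^+ i) * (j`!%:R^-1 * mxabs Y ^+ j)).
  (* The real numbers as a one-dimensional algebra over themselves. *)
  exact: (@expsumM_sub R R^o (mxabs X) (mxabs Y) m (mulrC _ _)).
rewrite mulr_sumr; apply: le_trans (mxabs_sum _ _ _) _; apply: ler_sum => i _.
rewrite mulr_sumr; apply: le_trans (mxabs_sum _ _ _) _; apply: ler_sum => j _.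
rewrite mulrACA; apply: le_trans (mxabsM _ _) _.
by apply: ler_pM; rewrite ?mxabs_ge0 ?mxabs_expterm.
Qed.

Lemma mxexp_intertwine X Y P : X * P = P * Y -> mxexp X * P = P * mxexp Y.
Proof.
move=> XP; have powP k : X ^+ k * P = P * Y ^+ k.
  elim: k => [|k IH]; first by rewrite !expr0 mulr1 mul1r.
  by rewrite !exprSr -mulrA XP !mulrA IH.
apply: mxcvg_unique (mxcvgM (mxexp_cvg X) (mxcvg_cst P)) _.
apply: mxcvg_eq (mxcvgM (mxcvg_cst P) (mxexp_cvg Y)) => m.
rewrite /expsum mulr_sumr mulr_suml; apply: eq_bigr => p _.
by rewrite /expterm -scalerAl -scalerAr powP.
Qed.

Lemma mxexp_comm X Z : GRing.comm Z X -> GRing.comm Z (mxexp X).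
Proof. by move=> cZX; apply/esym/mxexp_intertwine/esym. Qed.

Definition exp_poly m : {poly C} := \sum_(p < m) (p`!%:R)^-1 *: 'X^p.

Lemma expsum_horner m X : expsum m X = horner_mx X (exp_poly m).
Proof.
rewrite rmorph_sum; apply: eq_bigr => p _.
by rewrite /= horner_mxZ rmorphXn /= horner_mx_X.
Qed.

(** The series stops; isolating its linear term gives the shape required by [comm_horner_nilpotent]
    and [horner_nilpotent_eq0]. *)
Lemma mxexp_nilpotent (N : M) : nilpotent_elt N ->
  exists q, mxexp N = 1 + horner_mx N ('X + 'X ^+ 2 * q).
Proof.
move=> [k Nk]; exists (\sum_(p < k) (p.+2`!%:R)^-1 *: 'X^p).
have -> : 1 + horner_mx N ('X + 'X ^+ 2 * \sum_(p < k) (p.+2`!%:R)^-1 *: 'X^p) = expsum k.+2 N.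
  rewrite expsum_horner -[1](rmorph1 (horner_mx N)) -rmorphD; congr (horner_mx N _).
  rewrite /exp_poly !big_ord_recl /= !fact0 invr1 !scale1r expr0 !addrA mulr_sumr.
  congr (_ + _ + _); apply: eq_bigr => p _.
  by rewrite -scalerAr -exprD.
apply: mxcvg_unique (mxexp_cvg N) _ => e e0; exists k.+2 => m km.
rewrite /expsum -!(big_mkord xpredT (expterm N)) (big_cat_nat (n := k.+2)) //= [X in X - _]addrC addrK.
rewrite big_nat_cond big1 ?mxabs0 // => p /andP[/andP[kp _] _].
by rewrite /expterm -(subnK (ltnW (ltnW kp))) exprD Nk mulr0 scaler0.
Qed.

End MatrixExp.

(** * The complex exponential and its kernel *)

Section ScalarExp.
Local Notation C := R[i].
Implicit Types z w : C.

(** As the 1 x 1 case, it inherits convergence and the addition law from the matrix exponential. *)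
Definition cexp z : C := mxexp (z%:M : 'M[C]_1) 0 0.

Lemma cexp_cvg z : null (fun m => cabs ((exp_poly m).[z] - cexp z)).
Proof.
have e m : expsum m (z%:M : 'M[C]_1) 0 0 = (exp_poly m).[z].
  by rewrite expsum_horner -diag_const_mx horner_mx_diag 2!mxE eqxx mulr1n mxE.
by apply: null_le (mxcvg_entry 0 0 (mxexp_cvg (z%:M : 'M[C]_1))) => m; rewrite -e.
Qed.

Lemma cabs_limit_unique (u : nat -> C) (k : nat -> nat) l l' :
  (forall m, (m <= k m)%N) -> null (fun m => cabs (u m - l)) ->
  null (fun m => cabs (u (k m) - l')) -> l = l'.
Proof.
move=> km hl hl'; apply/eqP; rewrite -subr_eq0; apply/eqP/cabs0_eq/null_cst.
have hk : null (fun m => cabs (u (k m) - l)).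
  by move=> e /hl[N hN]; exists N => m Nm; apply: hN; apply: leq_trans Nm (km m).
apply: null_le (nullD hk hl') => m; rewrite -[cabs (u (k m) - l)]cabsN opprB.
by apply: le_trans (cabsD _ _); rewrite addrA subrK.
Qed.

Lemma cexpD z w : cexp (z + w) = cexp z * cexp w.
Proof.
rewrite /cexp raddfD mxexpD; last exact: comm_mx_scalar.
by rewrite mxE big_ord1.
Qed.

Lemma cexp_real (x : R) : cexp x%:C%C = (exp x)%:C%C.
Proof.
apply: (@cabs_limit_unique _ id _ _ (fun m => leqnn m) (cexp_cvg _)).
apply: null_le (rexpsum_cvg x) => m.
have -> : (exp_poly m).[x%:C%C] = (rexpsum m x)%:C%C.
  rewrite horner_sum rmorph_sum; apply: eq_bigr => p _.
  by rewrite /= hornerZ hornerXn rmorphM rmorphXn fmorphV rmorph_nat.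
by rewrite -rmorphB /cabs /= normr0 addr0.
Qed.

Lemma cexp_imag (y : R) : cexp (0 +i* y)%C = (cos y +i* sin y)%C.
Proof.
apply: (@cabs_limit_unique _ (fun m => m.*2) _ _ _ (cexp_cvg _)) => [m|].
  by rewrite -addnn leq_addr.
pose c m : R := \sum_(p < m) cos_n p * (Rsqr y) ^+ p.
pose s m : R := \sum_(p < m) sin_n p * (Rsqr y) ^+ p.
have series (a : nat -> R) l : infinite_sum (fun i => Rmult (a i) (pow (Rsqr y) i)) l ->
    null (fun m => `|\sum_(p < m) a p * (Rsqr y) ^+ p - l|).
  move=> h e /RltP/h[N hN]; exists N.+1 => -[//|m] Nm.
  have /RltP := hN m (elimT ssrnat.leP (Nm : (N <= m)%N)); rewrite RdistE sum_f_R0E big_mkord.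
  apply: le_lt_trans; rewrite le_eqVlt; apply/orP; left; apply/eqP; congr (`|_ - _|).
  by apply: eq_bigr => p _; rewrite RpowE.
have hc : null (fun m => `|c m - cos y|).
  by apply: series; rewrite /cos; case: (exist_cos _).
have hs : null (fun m => `|y * s m - sin y|).
  have [l hl sl] : exists2 l, null (fun m => `|s m - l|) & sin y = y * l.
    rewrite /sin; case: (exist_sin _) => l hl; exists l => //; exact: series.
  apply: null_le (nullZ (normr_ge0 y) hl) => m.
  by rewrite sl -mulrBr normrM.
apply: null_le (nullD hc hs) => m.
(* The first 2m terms at iy are exactly m terms of the cosine series and m of the sine series; hence
   the passage to the subsequence of even partial sums. *)
suff -> : (exp_poly m.*2).[(0 +i* y)%C] = (c m +i* (y * s m))%C by [].
set w : C := (0 +i* y)%C.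
have sq : w ^+ 2 = (- Rsqr y)%:C%C.
  by rewrite expr2 /Rsqr; apply/eqP; rewrite eq_complex /= !mul0r mulr0 addr0 sub0r !eqxx.
have even p : w ^+ p.*2 = ((-1) ^+ p * (Rsqr y) ^+ p)%:C%C.
  by rewrite -mul2n exprM sq -rmorphXn /= -exprNn.
have cosE p : cos_n p = (-1) ^+ p / (p.*2)`!%:R.
  by rewrite /cos_n RdivE RpowE INRE factE multE mul2n.
have sinE p : sin_n p = (-1) ^+ p / (p.*2.+1)`!%:R.
  by rewrite /sin_n RdivE RpowE INRE factE multE plusE mul2n addn1.
have inv k : (k`!%:R : C)^-1 = (k`!%:R^-1 : R)%:C%C by rewrite fmorphV rmorph_nat.
have epS k : (exp_poly k.+1).[w] = (exp_poly k).[w] + (k`!%:R)^-1 * w ^+ k.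
  by rewrite /exp_poly big_ord_recr /= hornerD hornerZ hornerXn.
have cS k : c k.+1 = c k + cos_n k * (Rsqr y) ^+ k by rewrite /c big_ord_recr.
have sS k : s k.+1 = s k + sin_n k * (Rsqr y) ^+ k by rewrite /s big_ord_recr.
elim: m => [|m IH].
  by rewrite /exp_poly /c /s !big_ord0 horner0 mulr0.
rewrite doubleS !epS IH cS sS exprS even cosE sinE !inv.
apply/eqP; rewrite eq_complex /=; apply/andP; split; apply/eqP; ring.
Qed.

Lemma int_of_Z (k : Z) : exists m : int, IZR k = m%:~R.
Proof.
case: k => [|p|p]; first by exists 0.
  by exists (Posz (nat_of_pos p)); rewrite IZRposE INRE.
by exists (- Posz (nat_of_pos p)); rewrite mulrNz -[IZR _]/(Ropp (IZR (Z.pos p))) IZRposE INRE.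
Qed.

Definition period : C := (0 +i* (2 * PI))%C.

Lemma period_neq0 : period != 0.
Proof.
apply/negP => /eqP[] /eqP; rewrite mulf_eq0 pnatr_eq0 /= => /eqP.
exact: PI_neq0.
Qed.

Lemma cexp_eq1 z : cexp z = 1 -> exists m : int, z = m%:~R * period.
Proof.
case: z => x y; have -> : (x +i* y)%C = x%:C%C + (0 +i* y)%C :> C.
  by apply/eqP; rewrite eq_complex /= addr0 add0r !eqxx.
rewrite cexpD cexp_real cexp_imag => /eqP; rewrite eq_complex /= !mul0r subr0 addr0.
move=> /andP[/eqP excos /eqP exsin].
have ex0 : 0 < exp x by apply/RltP/exp_pos.
have sin0 : sin y = 0 by apply/eqP; move/eqP: exsin; rewrite mulf_eq0 gt_eqF.
have cos0 : 0 < cos y by rewrite -(pmulr_rgt0 _ ex0) excos ltr01.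
have cs : cos y ^+ 2 + sin y ^+ 2 = 1.
  by rewrite addrC; have := sin2_cos2 y; rewrite /Rsqr.
have cos1 : cos y = 1.
  apply/eqP; rewrite -(eqrXn2 (n := 2)) ?ltW // expr1n -cs sin0.
  by rewrite expr0n addr0.
have x0 : x = 0.
  by apply: exp_inv; rewrite exp_0 -[LHS]mulr1 -cos1 excos.
(* Halving the angle: cos 2h = 1 forces sin h = 0, so h is a multiple of pi and y one of 2 pi,
   whereas sin y = 0 alone would give only multiples of pi. *)
pose h := (y / 2%:R)%R; have hE : y = (h + h)%R by apply: splitr.
have [k hk] : exists k : Z, h = (IZR k * PI)%R.
  apply: sin_eq_0_0; have h1 : (1 = cos h * cos h - sin h * sin h)%R.
    by rewrite -cos1 hE; apply: cosD.
  have h2 : (sin h * sin h + cos h * cos h = 1)%R by apply: sin2_cos2.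
  apply/eqP; rewrite -sqrf_eq0 expr2; apply/eqP; lra.
have [m hm] := int_of_Z k; exists m.
rewrite x0 add0r -(rmorph_int (real_complex R)) hE hk hm /period.
apply/eqP; rewrite eq_complex /=; apply/andP; split; apply/eqP; ring.
Qed.

End ScalarExp.

(** * Exponentials of diagonalizable matrices *)

Section MatrixExpDiag.
Variable n : nat.
Local Notation C := R[i].
Local Notation M := 'M[C]_n.+1.

Lemma mxexp_diag (d : 'rV[C]_n.+1) : mxexp (diag_mx d) = diag_mx (map_mx cexp d).
Proof.
apply: mxcvg_unique (mxexp_cvg _) _; apply: mxcvgP => i j.
apply: null_le (cexp_cvg (d 0 i)) => m.
have -> : expsum m (diag_mx d : M) i j = (exp_poly m).[d 0 i] *+ (i == j).
  by rewrite expsum_horner horner_mx_diag 2!mxE; case: (i =P j) => [->|].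
rewrite 2!mxE; case: (i =P j) => [->|_] /=; first by rewrite !mulr1n.
by rewrite !mulr0n subrr cabs0 cabs_ge0.
Qed.

Lemma mxexp_conj_diag (P : M) (d : 'rV[C]_n.+1) : P \in unitmx ->
  mxexp (invmx P *m diag_mx d *m P) = invmx P *m diag_mx (map_mx cexp d) *m P.
Proof.
move=> uP; set X := _ *m P.
have : P * X = diag_mx d * P by rewrite /X -!mulmxE !mulmxA mulmxV // mul1mx.
move=> /esym/mxexp_intertwine; rewrite mxexp_diag => h.
by rewrite -mulmxA [X in _ *m X]h mulKmx.
Qed.

End MatrixExpDiag.

(** * Interpolation and two commutator identities *)

Lemma poly_interpolation (F : fieldType) (s : seq F) (f : F -> F) :
  exists g : {poly F}, {in s, forall w, g.[w] = f w}.
Proof.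
elim: s => [|a s [g hg]]; first by exists 0.
have [sa|nsa] := boolP (a \in s).
  by exists g => w; rewrite inE => /orP[/eqP->|]; apply: hg.
pose q := \prod_(b <- s) ('X - b%:P).
have q0 w : (q.[w] == 0) = (w \in s) by rewrite -[_ == 0]/(root q w) root_prod_XsubC.
exists (g + ((f a - g.[a]) / q.[a]) *: q) => w; rewrite inE hornerD hornerZ.
case/orP => [/eqP->|sw]; first by rewrite divfK ?q0 // addrC subrK.
by rewrite (eqP (_ : q.[w] == 0)) ?q0 // mulr0 addr0 hg.
Qed.

Lemma comm_cross (T : nzRingType) (a b x y : T) :
  GRing.comm a x -> GRing.comm b y -> GRing.comm (a + b) (x + y) ->
  a * y - y * a = x * b - b * x.
Proof.
rewrite /GRing.comm !mulrDl !mulrDr => ax by_; rewrite ax by_ -!addrA => /addrI.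
rewrite !addrA => /addIr e.
by apply/eqP; rewrite subr_eq addrAC eq_sym subr_eq e.
Qed.

(** Applied to a = D, b = D', u = e^D, v = e^D'. Since [u, b] = u [a, v] v' and [u] commutes with
    [a], [v] and [v'], it commutes with [u, b]: this is the input of [diagonalizable_ad2]. *)
Lemma comm_mul_split (T : nzRingType) (a b u v v' : T) :
  GRing.comm a u -> GRing.comm b v -> GRing.comm u v -> v * v' = 1 -> v' * v = 1 ->
  GRing.comm (a + b) (u * v) ->
  GRing.comm u (u * b - b * u) /\ u * (a * v - v * a) = (u * b - b * u) * v.
Proof.
move=> au bv uv vv' v'v ab.
have rel : u * (a * v - v * a) = (u * b - b * u) * v.
  apply/eqP; rewrite mulrBr mulrBl subr_eq addrAC eq_sym subr_eq; apply/eqP.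
  move: ab; rewrite /GRing.comm mulrDl mulrDr !mulrA au -[u * v * b]mulrA -bv !mulrA => ab.
  by rewrite addrC -ab addrC.
split=> //.
have cup : GRing.comm u (a * v - v * a).
  by apply: commrB; apply: commrM => //; apply: commr_sym.
have cuv' : GRing.comm u v'.
  transitivity (v' * v * (u * v')); first by rewrite v'v mul1r.
  by rewrite -mulrA [v * _]mulrA -uv -[u * v * v']mulrA vv' mulr1.
have -> : u * b - b * u = u * (a * v - v * a) * v' by rewrite rel -mulrA vv' mulr1.
by apply: commrM => //; apply: commrM.
Qed.

(** * From relations between exponentials to commutation *)

Section ExpCommutation.
Variable n : nat.
Local Notation C := R[i].
Local Notation M := 'M[C]_n.+1.
Local Notation ex := (@mxexp n).
Implicit Types A B D S X Y Z : M.

Lemma mxexp0 : ex 0 = 1.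
Proof.
have [|q ->] := @mxexp_nilpotent n 0; first by exists 1%N; rewrite expr1.
rewrite -[X in horner_mx _ (X + _)]mulr1 exprS -mulrA -mulrDr rmorphM /= horner_mx_X.
by rewrite mul0r addr0.
Qed.

Lemma mxexpVr X : ex X * ex (- X) = 1.
Proof. by rewrite -mxexpD ?subrr ?mxexp0 //; apply: commrN. Qed.

Lemma mxexpVl X : ex (- X) * ex X = 1.
Proof. by have := mxexpVr (- X); rewrite opprK. Qed.

Lemma mxexp_mulI X : injective ( *%R (ex X)).
Proof. by move=> Y Z /(congr1 ( *%R (ex (- X)))); rewrite !mulrA mxexpVl !mul1r. Qed.

Lemma mxexp_mulIr X : injective (fun Y => Y * ex X).
Proof.
by move=> Y Z /(congr1 (fun W => W * ex (- X))); rewrite -!mulrA mxexpVr !mulr1.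
Qed.

Lemma mxexp_scale_int X (k : int) : ex X = 1 -> ex (k%:~R *: X) = 1.
Proof.
move=> X1; have nat1 (m : nat) : ex (m%:R *: X) = 1.
  elim: m => [|m IH]; first by rewrite scale0r mxexp0.
  rewrite -natr1 scalerDl scale1r mxexpD ?IH ?X1 ?mulr1 //.
  by rewrite /GRing.comm -scalerAl -scalerAr.
case: k => m; first exact: nat1.
rewrite NegzE mulrNz scaleNr; have := mxexpVr (m.+1%:R *: X).
by rewrite nat1 mul1r.
Qed.

Lemma mxexp_diagonalizable D : diagonalizable D -> diagonalizable (ex D).
Proof.
move=> /diagonalizable_decomp[P uP [d ->]]; rewrite mxexp_conj_diag //.
exact: diagonalizable_conj.
Qed.

Lemma mxexp_comm2 X Y : GRing.comm X Y -> GRing.comm (ex X) (ex Y).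
Proof. by move=> cXY; apply/mxexp_comm/commr_sym/mxexp_comm/commr_sym. Qed.

Lemma mxexp_unipotent (N : M) : nilpotent_elt N -> nilpotent_elt (ex N - 1).
Proof.
move=> nN; have [q ->] := mxexp_nilpotent nN; rewrite addrC addKr.
have -> : 'X + 'X ^+ 2 * q = (1 + 'X * q) * 'X by ring.
rewrite rmorphM /= horner_mx_X; apply: nilpotent_eltM => //.
exact: comm_mx_horner.
Qed.

Lemma comm_mxexp_nilpotent Z (N : M) :
  nilpotent_elt N -> GRing.comm Z (ex N) -> GRing.comm Z N.
Proof.
move=> nN; have [q ->] := mxexp_nilpotent nN => cZ.
apply: (comm_horner_nilpotent (q := q)) => //.
by rewrite -[horner_mx _ _](addKr 1); apply: commrD => //; apply/commrN/commr1.
Qed.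

(** [N] commutes with its own exponential, which is also that of [N'], hence with [N']. Then N - N'
    is nilpotent with exponential 1, and e^X - 1 is X times an invertible matrix. *)
Lemma mxexp_nilpotent_inj (N N' : M) :
  nilpotent_elt N -> nilpotent_elt N' -> ex N = ex N' -> N = N'.
Proof.
move=> nN nN' e; have cNN : GRing.comm N N'.
  by apply: comm_mxexp_nilpotent => //; rewrite -e; apply: mxexp_comm.
have nB := nilpotent_eltB cNN nN nN'; have [q hq] := mxexp_nilpotent nB.
apply/eqP; rewrite -subr_eq0; apply/eqP; apply: (horner_nilpotent_eq0 (q := q) nB).
apply: (addrI 1); rewrite -hq addr0 mxexpD; last exact: commrN.
by rewrite e mxexpVr.
Qed.

Lemma mxexp_jordan_unique D (N : M) S (N' : M) :
  diagonalizable D -> nilpotent_elt N -> GRing.comm D N ->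
  diagonalizable S -> nilpotent_elt N' -> GRing.comm S N' ->
  ex D * ex N = S * ex N' -> ex D = S /\ N = N'.
Proof.
move=> dD nN cDN dS nN' cSN e.
have [p hp] := semisimple_part_horner (ex D * ex N).
have eD := hp _ _ (mxexp_diagonalizable dD) (mxexp_comm2 cDN) (mxexp_unipotent nN) erefl.
have eS := hp _ _ dS (mxexp_comm cSN) (mxexp_unipotent nN') e.
have e1 : ex D = S by rewrite eD -eS.
split=> //; apply: mxexp_nilpotent_inj => //.
by apply: (@mxexp_mulI D); rewrite e e1.
Qed.

Lemma comm_mxexp_parts Z D (N : M) :
  diagonalizable D -> nilpotent_elt N -> GRing.comm D N ->
  GRing.comm Z (ex D * ex N) -> GRing.comm Z (ex D) /\ GRing.comm Z N.
Proof.
move=> dD nN cDN cZ; have [p hp] := semisimple_part_horner (ex D * ex N).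
have eD := hp _ _ (mxexp_diagonalizable dD) (mxexp_comm2 cDN) (mxexp_unipotent nN) erefl.
have cZD : GRing.comm Z (ex D) by rewrite eD; apply: comm_mx_horner.
split=> //; apply: comm_mxexp_nilpotent => //; apply: (@mxexp_mulI D).
by rewrite mulrA -cZD -mulrA cZ !mulrA.
Qed.

Lemma jordan_decomposition A : exists D N : M,
  [/\ diagonalizable D, nilpotent_elt N, GRing.comm D N & A = D + N].
Proof.
have [p [dD nN]] := jordan_chevalley A.
exists (horner_mx A p), (A - horner_mx A p); split=> //.
  by apply: commrB => //; apply: comm_horner_mx.
by rewrite [RHS]addrC subrK.
Qed.

Section Parts.
Variables (A B DA NA DB NB : M).
Hypotheses (dA : diagonalizable DA) (nA : nilpotent_elt NA) (cA : GRing.comm DA NA).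
Hypotheses (dB : diagonalizable DB) (nB : nilpotent_elt NB) (cB : GRing.comm DB NB).
Hypotheses (AE : A = DA + NA) (BE : B = DB + NB).
Hypotheses (HAB : ex (A + B) = ex A * ex B) (HNAB : ex (- A - B) = ex (- A) * ex (- B)).

(** Multiplying the two hypotheses, e^A e^B e^(-A) e^(-B) = e^(A+B) e^(-A-B) = 1. *)
Lemma mxexp_mul_comm : ex A * ex B = ex B * ex A.
Proof.
have := mxexpVr (A + B); rewrite opprD HAB HNAB => e.
apply: (@mxexp_mulIr (- A)); rewrite -[RHS]mulrA mxexpVr mulr1.
by apply: (@mxexp_mulIr (- B)); rewrite mxexpVr -!mulrA -[RHS]e -!mulrA.
Qed.

Lemma mxexp_parts_comm :
  [/\ GRing.comm (ex DA) (ex DB), GRing.comm (ex DA) NB,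
      GRing.comm NA (ex DB) & GRing.comm NA NB].
Proof.
have EA : ex A = ex DA * ex NA by rewrite AE mxexpD.
have EB : ex B = ex DB * ex NB by rewrite BE mxexpD.
have [h1 h2] : GRing.comm (ex B) (ex DA) /\ GRing.comm (ex B) NA.
  by apply: comm_mxexp_parts => //; rewrite -EA; apply/commr_sym/mxexp_mul_comm.
have [h3 h4] : GRing.comm (ex DA) (ex DB) /\ GRing.comm (ex DA) NB.
  by apply: comm_mxexp_parts => //; rewrite -EB; apply: commr_sym.
have [h5 h6] : GRing.comm NA (ex DB) /\ GRing.comm NA NB.
  by apply: comm_mxexp_parts => //; rewrite -EB; apply: commr_sym.
by split.
Qed.

(** Compare with the Jordan decomposition of A + B. Injectivity of the exponential identifies the
    nilpotent part; the semisimple part, which its exponential does not determine, is then recovered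
    by subtraction. *)
Lemma mxexp_parts_add :
  [/\ diagonalizable (DA + DB), GRing.comm (DA + DB) (NA + NB) &
      ex (DA + DB) = ex DA * ex DB].
Proof.
have [cuv cuN cNv cNN] := mxexp_parts_comm.
have [D [N [dD nN cDN DNE]]] := jordan_decomposition (A + B).
have dS : diagonalizable (ex DA * ex DB).
  exact: diagonalizableM cuv (mxexp_diagonalizable dA) (mxexp_diagonalizable dB).
have nNN : nilpotent_elt (NA + NB) by apply: nilpotent_eltD.
have cS : GRing.comm (ex DA * ex DB) (NA + NB).
  apply/commr_sym/commrM; apply/commr_sym/commrD => //.
    by apply: commr_sym; apply: mxexp_comm; apply: commr_sym.
  by apply: commr_sym; apply: mxexp_comm; apply: commr_sym.
have E : ex D * ex N = ex DA * ex DB * ex (NA + NB).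
  rewrite -(mxexpD cDN) -DNE HAB AE BE (mxexpD cA) (mxexpD cB) (mxexpD cNN).
  rewrite -!mulrA; congr (_ * _); rewrite !mulrA; congr (_ * _).
  by apply: commr_sym; apply: mxexp_comm; apply: commr_sym.
have [] := mxexp_jordan_unique dD nN cDN dS nNN cS E.
move=> eD eN; have -> : DA + DB = D.
  by apply: (addIr N); rewrite -DNE AE BE addrACA -eN.
by split=> //; rewrite -eN.
Qed.

Lemma mxexp_comm_semisimple : GRing.comm DA (ex DB) /\ GRing.comm DB (ex DA).
Proof.
have [cuv _ _ _] := mxexp_parts_comm; have [_ _ eD] := mxexp_parts_add.
have cAu : GRing.comm DA (ex DA) by apply: mxexp_comm.
have cBv : GRing.comm DB (ex DB) by apply: mxexp_comm.
have cW : GRing.comm (DA + DB) (ex DA * ex DB) by rewrite -eD; apply: mxexp_comm.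
have [cuq rel] := comm_mul_split cAu cBv cuv (mxexpVr DB) (mxexpVl DB) cW.
have cuB : GRing.comm (ex DA) DB by apply: diagonalizable_ad2 cuq; apply: mxexp_diagonalizable.
split; last exact: commr_sym.
apply/eqP; rewrite -subr_eq0; apply/eqP; apply: (@mxexp_mulI DA).
by rewrite mulr0 rel cuB subrr mul0r.
Qed.

End Parts.

(* The logarithm is taken eigenvalue by eigenvalue, so that it is a polynomial in the exponential. *)
Lemma mxexp_log_poly D : diagonalizable D -> exists g, ex (horner_mx (ex D) g) = ex D.
Proof.
move=> /diagonalizable_decomp[P uP [d ->]]; rewrite mxexp_conj_diag //.
pose lg w := epsilon (inhabits 0) (fun z => cexp z = w).
have [g hg] := poly_interpolation [seq cexp (d 0 j) | j <- enum 'I_n.+1] lg.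
exists g; rewrite horner_mx_uconjC // horner_mx_diag mxexp_conj_diag //.
congr (_ *m diag_mx _ *m _); apply/rowP => j; rewrite !mxE hg.
  exact: (epsilon_spec (inhabits 0) (fun z => cexp z = cexp (d 0 j)) (ex_intro _ _ erefl)).
by apply: map_f; rewrite mem_enum.
Qed.

Lemma mxexp_eq1_int X : diagonalizable X -> ex X = 1 -> int_diagonalizable (period^-1 *: X).
Proof.
move=> /diagonalizable_decomp[P uP [d ->]]; rewrite mxexp_conj_diag // => e.
have e1 : diag_mx (map_mx cexp d) = 1.
  have := congr1 (fun Y => P *m Y *m invmx P) e.
  by rewrite /= !mulmxA mulmxV // mul1mx mulmxK // mulmx1 mulmxV.
have /fin_all_exists[m hm] j : exists m : int, d 0 j = m%:~R * period.
  apply: cexp_eq1; have /matrixP/(_ j j) := e1.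
  by rewrite !mxE eqxx !mulr1n.
exists P => //; exists (\row_j m j).
rewrite scalemxAl scalemxAr -linearZ /=; congr (_ *m diag_mx _ *m _).
by apply/rowP => j; rewrite !mxE hm mulrCA mulVf ?mulr1 // period_neq0.
Qed.

Lemma complex_archimedean (x : C) : exists m : nat, `|x| <= m%:R.
Proof.
rewrite normc_def; set r := Num.sqrt _; exists (Num.bound r).
by rewrite -(rmorph_nat (real_complex R)) lecR ltW // archi_boundP // sqrtr_ge0.
Qed.

Lemma comm_scale2 (a b : C) X Y : GRing.comm X Y -> GRing.comm (a *: X) (b *: Y).
Proof. by move=> cXY; rewrite /GRing.comm -!scalerAl -!scalerAr cXY !scalerA mulrC. Qed.

Lemma nilpotent_eltZ (a : C) X : nilpotent_elt X -> nilpotent_elt (a *: X).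
Proof. by move=> [m Xm]; exists m; rewrite exprZn Xm scaler0. Qed.

(** Removing the logarithms [SA] and [SB], which commute with [DA], [DB] and each other, does not
    change [DA, DB], and reduces the claim to integer spectra after division by the period. *)
Lemma semisimple_exp_pencil_comm DA DB :
  diagonalizable DA -> diagonalizable DB ->
  GRing.comm DA (ex DB) -> GRing.comm DB (ex DA) ->
  (forall k l : int, diagonalizable (k%:~R *: DA + l%:~R *: DB)) ->
  (forall k l : int,
     ex (k%:~R *: DA + l%:~R *: DB) = ex (k%:~R *: DA) * ex (l%:~R *: DB)) ->
  GRing.comm DA DB.
Proof.
move=> dA dB cAv cBu dAB exAB.
have [g hg] := mxexp_log_poly dA; have [h hh] := mxexp_log_poly dB.
have dSA := diagonalizable_horner g (mxexp_diagonalizable dA).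
have dSB := diagonalizable_horner h (mxexp_diagonalizable dB).
have cASA : GRing.comm DA (horner_mx (ex DA) g) by apply/comm_mx_horner/mxexp_comm.
have cBSB : GRing.comm DB (horner_mx (ex DB) h) by apply/comm_mx_horner/mxexp_comm.
have cASB : GRing.comm DA (horner_mx (ex DB) h) by apply: comm_mx_horner.
have cBSA : GRing.comm DB (horner_mx (ex DA) g) by apply: comm_mx_horner.
have cSS : GRing.comm (horner_mx (ex DA) g) (horner_mx (ex DB) h).
  by apply/comm_mx_horner/comm_horner_mx/commr_sym/mxexp_comm/commr_sym.
move: (horner_mx (ex DA) g) (horner_mx (ex DB) h) hg hh dSA dSB cASA cBSB cASB cBSA cSS.
move=> SA SB exSA exSB dSA dSB cASA cBSB cASB cBSA cSS.
pose A' := DA - SA; pose B' := DB - SB.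
have eA k : k *: DA = k *: A' + k *: SA by rewrite -scalerDr subrK.
have eB k : k *: DB = k *: B' + k *: SB by rewrite -scalerDr subrK.
have one D S : GRing.comm D S -> ex S = ex D -> ex (D - S) = 1.
  by move=> cDS eS; rewrite mxexpD ?mxexpVr; [rewrite -eS mxexpVr | apply: commrN].
have cA'SA : GRing.comm A' SA by apply/commr_sym/commrB => //; apply: commr_sym.
have cB'SB : GRing.comm B' SB by apply/commr_sym/commrB => //; apply: commr_sym.
have cA'SB : GRing.comm A' SB by apply/commr_sym/commrB => //; apply: commr_sym.
have cB'SA : GRing.comm B' SA by apply/commr_sym/commrB => //; apply: commr_sym.
have exA' k : ex (k%:~R *: DA) = ex (k%:~R *: SA).
  by rewrite eA mxexpD ?(mxexp_scale_int _ (one _ _ cASA exSA)) ?mul1r //; apply: comm_scale2.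
have exB' k : ex (k%:~R *: DB) = ex (k%:~R *: SB).
  by rewrite eB mxexpD ?(mxexp_scale_int _ (one _ _ cBSB exSB)) ?mul1r //; apply: comm_scale2.
have DAE : DA = A' + SA by rewrite subrK.
have DBE : DB = B' + SB by rewrite subrK.
clearbody A' B'.
have cAB' : GRing.comm (period^-1 *: A') (period^-1 *: B').
  apply: integral_pencil_comm (@complex_archimedean) _ => k l.
  have -> : k%:~R *: (period^-1 *: A') + l%:~R *: (period^-1 *: B') =
      period^-1 *: (k%:~R *: A' + l%:~R *: B').
    by rewrite scalerDr !scalerA; congr (_ *: _ + _ *: _); apply: mulrC.
  have E : k%:~R *: DA + l%:~R *: DB =
      (k%:~R *: A' + l%:~R *: B') + (k%:~R *: SA + l%:~R *: SB).
    by rewrite eA eB addrACA.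
  have cX : GRing.comm (k%:~R *: A' + l%:~R *: B') (k%:~R *: SA + l%:~R *: SB).
    by apply: commrD; apply: commr_sym; apply: commrD; apply: commr_sym; apply: comm_scale2.
  have cS2 : GRing.comm (k%:~R *: SA) (l%:~R *: SB) by apply: comm_scale2.
  have cDS : GRing.comm (k%:~R *: DA + l%:~R *: DB) (k%:~R *: SA + l%:~R *: SB).
    by apply: commrD; apply: commr_sym; apply: commrD; apply: comm_scale2; apply: commr_sym.
  have dS2 := diagonalizableD cS2 (diagonalizableZ k%:~R dSA) (diagonalizableZ l%:~R dSB).
  have dX : diagonalizable (k%:~R *: A' + l%:~R *: B').
    have -> : k%:~R *: A' + l%:~R *: B' =
      (k%:~R *: DA + l%:~R *: DB) - (k%:~R *: SA + l%:~R *: SB) by rewrite E addrK.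
    exact: diagonalizableB cDS (dAB k l) dS2.
  apply: mxexp_eq1_int dX _.
  (* Both exponentials reduce to that of kSA + lSB, which is invertible and cancels, leaving
     exponential 1 for kA' + lB'. *)
  have := exAB k l; rewrite exA' exB' -(mxexpD cS2) E (mxexpD cX) => e.
  by apply: (@mxexp_mulIr (k%:~R *: SA + l%:~R *: SB)); rewrite mul1r.
have cA'B' : GRing.comm A' B'.
  have := comm_scale2 period period cAB'.
  by rewrite !scalerA mulfV ?period_neq0 // !scale1r.
rewrite DAE DBE; apply: commrD; apply: commr_sym; apply: commrD => //; exact: commr_sym.
Qed.

Theorem exp_pencil_comm A B :
  (forall k l : int,
     ex (k%:~R *: A + l%:~R *: B) = ex (k%:~R *: A) * ex (l%:~R *: B)) ->
  GRing.comm A B.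
Proof.
move=> H; have [DA [NA [dA nA cA AE]]] := jordan_decomposition A.
have [DB [NB [dB nB cB BE]]] := jordan_decomposition B.
have AkE (k : int) : k%:~R *: A = k%:~R *: DA + k%:~R *: NA by rewrite AE scalerDr.
have BkE (k : int) : k%:~R *: B = k%:~R *: DB + k%:~R *: NB by rewrite BE scalerDr.
have HN k l : ex (- (k%:~R *: A) - l%:~R *: B) = ex (- (k%:~R *: A)) * ex (- (l%:~R *: B)).
  by have := H (- k) (- l); rewrite !mulrNz !scaleNr.
have parts k l := @mxexp_parts_add _ _ _ _ _ _ (diagonalizableZ k%:~R dA)
  (nilpotent_eltZ k%:~R nA) (comm_scale2 _ _ cA) (diagonalizableZ l%:~R dB)
  (nilpotent_eltZ l%:~R nB) (comm_scale2 _ _ cB) (AkE k) (BkE l) (H k l) (HN k l).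
have H1 : ex (A + B) = ex A * ex B by have := H 1 1; rewrite !scale1r.
have HN1 : ex (- A - B) = ex (- A) * ex (- B) by have := HN 1 1; rewrite !scale1r.
have [_ _ _ cNN] := mxexp_parts_comm dA nA cA dB nB cB AE BE H1 HN1.
have [cAv cBu] := mxexp_comm_semisimple dA nA cA dB nB cB AE BE H1 HN1.
have dAB k l : diagonalizable (k%:~R *: DA + l%:~R *: DB) by have [] := parts k l.
have exAB k l : ex (k%:~R *: DA + l%:~R *: DB) = ex (k%:~R *: DA) * ex (l%:~R *: DB).
  by have [] := parts k l.
have cD := semisimple_exp_pencil_comm dA dB cAv cBu dAB exAB.
have [_ cDN _] := mxexp_parts_add dA nA cA dB nB cB AE BE H1 HN1.
have rel := comm_cross cA cB cDN.
have cAN : GRing.comm DA NB.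
  (* Rewritten as [NA, DB], the commutator involves only matrices that commute with [DA]. *)
  apply: diagonalizable_ad2 dA _; rewrite rel.
  by apply: commrB; apply: commrM.
have cNB : GRing.comm NA DB.
  by apply/eqP; rewrite -subr_eq0 -rel cAN subrr.
rewrite AE BE; apply: commrD; apply: commr_sym; apply: commrD => //; exact: commr_sym.
Qed.

End ExpCommutation.

(** * Transfer to the concrete definitions *)

Section Transfer.

Definition complex_of (z : Defs.C) : R[i] := (Defs.re z +i* Defs.im z)%C.

Lemma complex_of_inj : injective complex_of.
Proof. by move=> [a b] [c d] [-> ->]. Qed.

Lemma complex_ofB z w : complex_of (Csub z w) = complex_of z - complex_of w.
Proof. by []. Qed.

Lemma complex_ofM z w : complex_of (Cmul z w) = complex_of z * complex_of w.
Proof. by []. Qed.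

Lemma complex_of_real (x : R) : complex_of (RtoC x) = x%:C%C.
Proof. by []. Qed.

Lemma complex_of_sum (f : nat -> Defs.C) m :
  complex_of (Csum f m) = \sum_(k < m) complex_of (f k).
Proof. by elim: m => [|m IH]; rewrite ?big_ord0 // big_ord_recr -IH. Qed.

Lemma sqrtr_sum_le (K : rcfType) (a b : K) : Num.sqrt (a * a + b * b) <= `|a| + `|b|.
Proof.
rewrite -[X in _ <= X]ger0_norm ?addr_ge0 // -[X in _ <= X]sqrtr_sqr ler_wsqrtr // -!expr2.
by rewrite sqrrD !real_normK ?num_real // addrAC lerDl mulrn_wge0 // mulr_ge0.
Qed.

Lemma normrD_le_sqrtr (K : rcfType) (a b : K) : `|a| + `|b| <= 2%:R * Num.sqrt (a * a + b * b).
Proof.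
rewrite mulr_natl mulr2n lerD // -[X in X <= _]sqrtr_sqr ler_wsqrtr // expr2.
  by rewrite lerDl -expr2 sqr_ge0.
by rewrite lerDr -expr2 sqr_ge0.
Qed.

Lemma Cmod_cabs z : Cmod z <= cabs (complex_of z).
Proof.
by rewrite /Cmod RsqrtE; apply: sqrtr_sum_le.
Qed.

Lemma cabs_Cmod z : cabs (complex_of z) <= 2%:R * Cmod z.
Proof.
by rewrite /Cmod RsqrtE; apply: normrD_le_sqrtr.
Qed.

Lemma CconvP (u : nat -> Defs.C) l :
  Cconv u l <-> null (fun m => cabs (complex_of (u m) - complex_of l)).
Proof.
split=> h e e0.
  have e2 : 0 < e / 2%:R by rewrite divr_gt0.
  have [N hN] := h _ (elimT RltP e2); exists N => m /ssrnat.leP Nm.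
  rewrite -complex_ofB; apply: le_lt_trans (cabs_Cmod _) _.
  by rewrite mulrC -ltr_pdivlMr //; apply/RltP; apply: hN.
have [N hN] := h e (introT RltP e0); exists N => m /ssrnat.leP Nm.
apply/RltP; apply: le_lt_trans (Cmod_cabs _) _; rewrite complex_ofB; exact: hN.
Qed.

Variable n : nat.

Definition mx_of (A : Mat) : 'M[R[i]]_n.+1 := \matrix_(i, j) complex_of (A i j).

Lemma mx_ofM A B : mx_of (Mmul n.+1 A B) = mx_of A * mx_of B.
Proof.
apply/matrixP => i j; rewrite !mxE complex_of_sum; apply: eq_bigr => k _.
by rewrite complex_ofM !mxE.
Qed.

Lemma mx_ofD A B : mx_of (Madd A B) = mx_of A + mx_of B.
Proof. by apply/matrixP => i j; rewrite !mxE. Qed.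

Lemma mx_of_Zscale (k : Z) (m : int) A : IZR k = m%:~R -> mx_of (Zscale k A) = m%:~R *: mx_of A.
Proof.
move=> km; apply/matrixP => i j; rewrite !mxE complex_ofM complex_of_real km.
by rewrite rmorph_int.
Qed.

Lemma mx_ofX A p : mx_of (Mpow n.+1 A p) = mx_of A ^+ p.
Proof.
elim: p => [|p IH]; last by rewrite exprS -IH -mx_ofM.
apply/matrixP => i j; rewrite !mxE /= /Mid -val_eqE /=.
by case: (PeanoNat.Nat.eqb_spec i j) => [->|/eqP/negPf->]; rewrite ?eqxx.
Qed.

Lemma mx_of_partial A m : mx_of (Mexp_partial n.+1 A m) = expsum m (mx_of A).
Proof.
apply/matrixP => i j; rewrite !mxE complex_of_sum summxE; apply: eq_bigr => p _.
rewrite complex_ofM complex_of_real !mxE -mx_ofX !mxE RinvE INRE factE.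
by rewrite fmorphV rmorph_nat.
Qed.

(** [mexp] is picked by [epsilon], so its specification is available only after a limit is
    exhibited; uniqueness of limits then identifies the entries. *)
Lemma mx_of_mexp A : mx_of (mexp n.+1 A) = mxexp (mx_of A).
Proof.
have h (i j : 'I_n.+1) : null (fun m => cabs (complex_of (Mexp_partial n.+1 A m i j) - mxexp (mx_of A) i j)).
  apply: null_le (mxcvg_entry i j (mxexp_cvg (mx_of A))) => m.
  by rewrite -mx_of_partial [mx_of _ i j]mxE.
have ex_lim : is_mexp n.+1 A (mexp n.+1 A).
  (* [inord] sends out-of-range indices to some default index; [is_mexp] constrains in-range entries
     only. *)
  apply: epsilon_spec; exists (fun i j =>
    let z := mxexp (mx_of A) (inord i) (inord j) in mkC (complex.Re z) (complex.Im z)).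
  move=> i j /ssrnat.ltP hi /ssrnat.ltP hj; apply/CconvP.
  have := h (inord i) (inord j); rewrite !inordK // /complex_of /=.
  by case: (mxexp _ _ _).
apply/matrixP => i j; rewrite mxE; apply/eqP; rewrite -subr_eq0; apply/eqP/cabs0_eq/null_cst.
have /CconvP h' := ex_lim i j (elimT ssrnat.ltP (ltn_ord i)) (elimT ssrnat.ltP (ltn_ord j)).
apply: null_le (nullD h' (h i j)) => m.
rewrite -[cabs (_ - complex_of _)]cabsN opprB; apply: le_trans (cabsD _ _).
by rewrite addrA subrK.
Qed.

Lemma mx_of_Meq A B : Meq n.+1 A B <-> mx_of A = mx_of B.
Proof.
split=> [h|/matrixP h i j /ssrnat.ltP hi /ssrnat.ltP hj].
  by apply/matrixP => i j; rewrite !mxE h //; apply/ssrnat.ltP.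
by have := h (Ordinal hi) (Ordinal hj); rewrite !mxE => /complex_of_inj.
Qed.

Lemma Z_of_int (m : int) : exists k : Z, IZR k = m%:~R.
Proof.
case: m => m; first by exists (Z.of_nat m); rewrite -INR_IZR_INZ INRE.
exists (Z.opp (Z.of_nat m.+1)).
by rewrite opp_IZR -INR_IZR_INZ INRE NegzE mulrNz.
Qed.

End Transfer.

Theorem theorem1 (n : nat) (A B : Mat) :
  (forall k l : Z,
     Meq n (mexp n (Madd (Zscale k A) (Zscale l B)))
           (Mmul n (mexp n (Zscale k A)) (mexp n (Zscale l B)))) ->
  Meq n (Mmul n A B) (Mmul n B A).
Proof.
(* Size 0 has no entries to compare; positive sizes give the matrix ring in which the rest takes
   place. *)
case: n => [_ i j /ssrnat.ltP //|n H].
apply/mx_of_Meq; rewrite !mx_ofM; apply: exp_pencil_comm => k l.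
have [k' hk] := Z_of_int k; have [l' hl] := Z_of_int l.
have /mx_of_Meq := H k' l'.
by rewrite mx_ofM !mx_of_mexp mx_ofD !(mx_of_Zscale _ _ hk, mx_of_Zscale _ _ hl).
Qed.
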